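(* Let $1\le q<p<\infty$ and $\alpha\in[0,1]$. (1) If $q\ge2$, then there is a coarse map $f\colon\ell_p\to\ell_q$ which is also expanding at rate $\alpha$ if and only if $\alpha>\frac{p-q}{p}$. (2) If $q\le2<p$, then there is a coarse map $f\colon\ell_p\to\ell_q$ which is also expanding at rate $\alpha$ if and only if $\alpha>\frac{p-2}{p}$.
   Context: A map $f\colon X\to Y$ between Banach spaces is coarse if $\omega_f(t)=\sup\{\|f(x)-f(z)\| : \|x-z\|\le t\}<\infty$ for all $t\ge 0$. For $\alpha\in[0,1]$, a map $f\colon X\to Y$ between Banach spaces is expanding at rate $\alpha$ if for every $L>0$ there is a map $\rho\colon[0,\infty)\to[0,\infty)$ with $\lim_{t\to\infty}\rho(t)=\infty$ such that, for all $x,z\in X$, $\|x-z\|\ge L\max\{\|x\|^\alpha,\|z\|^\alpha\}+L$ implies $\|f(x)-f(z)\|\ge\rho(\|x-z\|)$ (for $\alpha=0$ read $\|x\|^0=1$). *)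

(* Defs.v *)
From HB Require Import structures.
From mathcomp Require Import all_boot all_order all_algebra.
From mathcomp Require Import all_classical all_reals all_analysis.

Set Implicit Arguments.
Unset Strict Implicit.
Unset Printing Implicit Defensive.

Import Order.TTheory GRing.Theory Num.Theory.
Import numFieldNormedType.Exports.

Local Open Scope classical_set_scope.
Local Open Scope ring_scope.

Lemma lee1_fin (R : realType) (p : R) : 1 <= p -> (1 <= p%:E)%E.
Proof. by rewrite lee_fin. Qed.

(* The real Banach space l_p: every sequence is measurable, and the only null
   set of the counting measure is empty, so that no quotient of LfunType is
   needed.  The proof p1 is a parameter of the type but an irrelevant one. *)
Definition lp (R : realType) (p : R) (p1 : 1 <= p) : Type :=
  LfunType (@counting nat R) (lee1_fin p1).

Lemma continuous_norm_powR (R : realType) (p : R) : 0 < p ->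
  continuous (fun x : R => `|x| `^ p).
Proof.
move=> p0 x; have [->|x0] := eqVneq x 0; last first.
  apply: (@cvg_comp _ _ _ Num.norm (fun y : R => y `^ p) _ (nbhs `|x|)).
    exact: (@norm_continuous _ R x).
  apply: (@differentiable_continuous R R R `|x| (fun y : R => y `^ p)).
  apply/derivable1_diffP.
  by apply: derivable_powR; rewrite in_itv/= andbT normr_gt0.
rewrite /continuous_at normr0 powR0 ?gt_eqF//; apply/cvgrPdist_lt => e e0.
have d0 : 0 < e `^ p^-1 by exact: powR_gt0.
apply: filterS (@cvgr0_norm_lt _ R _ _ _ id cvg_id _ d0) => y yd.
rewrite sub0r normrN ger0_norm ?powR_ge0//.
have := @gt0_ltr_powR _ _ p0 `|y| (e `^ p^-1).
rewrite !nnegrE normr_ge0 ltW// => /(_ isT isT yd).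
by rewrite -powRrM mulVf ?gt_eqF// powRr1// ltW.
Qed.

Section lp_banach.
Context (R : realType) (p : R) (p1 : 1 <= p).

HB.instance Definition _ := GRing.Lmodule.on (lp p1).

Definition lp_norm (f : lp p1) : R :=
  fine ('N[@counting nat R]_p%:E[EFin \o (f : nat -> R)])%E.

Let p0 : 0 < p. Proof. exact: lt_le_trans p1. Qed.

Lemma lp_normE (f : lp p1) :
  (lp_norm f)%:E = 'N[@counting nat R]_p%:E[EFin \o (f : nat -> R)]%E.
Proof. exact: finite_norm_fine. Qed.

Lemma lp_norm_ge0 (f : lp p1) : 0 <= lp_norm f.
Proof. by rewrite -lee_fin lp_normE Lnorm_ge0. Qed.

Lemma lp_norm_series (f : lp p1) :
  ((lp_norm f `^ p)%:E = \sum_(k <oo) (`|(f : nat -> R) k| `^ p)%:E)%E.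
Proof.
rewrite -poweR_EFin lp_normE powR_Lnorm ?gt_eqF// ge0_integral_count//.
by move=> k; rewrite poweR_ge0.
Qed.

Lemma lp_psum_le (f : lp p1) n :
  \sum_(0 <= k < n) `|(f : nat -> R) k| `^ p <= lp_norm f `^ p.
Proof.
rewrite -lee_fin lp_norm_series -sumEFin.
by apply: nneseries_lim_ge => k _ _; rewrite lee_fin powR_ge0.
Qed.

Lemma lp_coord_le (f : lp p1) k : `|(f : nat -> R) k| <= lp_norm f.
Proof.
have := lp_psum_le f k.+1; rewrite big_nat_recr//= => h.
rewrite leNgt; apply/negP => /(@gt0_ltr_powR _ _ p0).
rewrite !nnegrE lp_norm_ge0 normr_ge0 => /(_ isT isT).
rewrite ltNge => /negP; apply; apply: le_trans h.
by rewrite lerDr; apply: sumr_ge0 => i _; exact: powR_ge0.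
Qed.

Lemma lp_bounded (g : nat -> R) (M : R) : 0 <= M ->
  (forall n, \sum_(0 <= k < n) `|g k| `^ p <= M `^ p) ->
  exists2 f : lp p1, (f : nat -> R) = g & lp_norm f <= M.
Proof.
move=> M0 gM.
have sM : (\sum_(k <oo) (`|g k| `^ p)%:E <= (M `^ p)%:E)%E.
  apply: lime_le; first by apply: is_cvg_nneseries => k *; rewrite lee_fin powR_ge0.
  by apply: nearW => n; rewrite sumEFin lee_fin.
have gL : g \in Lfun (@counting nat R) p%:E.
  rewrite inE; apply/andP; split; rewrite inE//=.
  rewrite /finite_norm Lnorm_counting//= poweR_lty//.
  by apply: le_lt_trans (ltry (M `^ p)).
exists (Lfun_Sub (lee1_fin p1) gL); first by [].
rewrite leNgt; apply/negP => /(@gt0_ltr_powR _ _ p0).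
rewrite !nnegrE lp_norm_ge0 M0 => /(_ isT isT).
by rewrite -lte_fin lp_norm_series ltNge sM.
Qed.

Lemma lp_normD (f g : lp p1) : lp_norm (f + g) <= lp_norm f + lp_norm g.
Proof. exact: ler_LnormD. Qed.

Lemma lp_normZ (a : R) (f : lp p1) : lp_norm (a *: f) = `|a| * lp_norm f.
Proof. by apply: EFin_inj; rewrite EFinM !lp_normE -LnormZ. Qed.

Lemma lp_norm0_eq0 (f : lp p1) : lp_norm f = 0 -> f = 0.
Proof.
move=> f0; apply/LfuneqP => k; apply/eqP.
by rewrite -normr_le0 -f0 lp_coord_le.
Qed.

HB.instance Definition _ :=
  Lmodule_isNormed.Build R (lp p1) lp_normD lp_normZ lp_norm0_eq0.

Lemma lp_complete (F : set_system (lp p1)) : ProperFilter F -> cauchy F -> cvg F.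
Proof.
move=> FF Fc.
have Fex (e : R) : 0 < e -> exists x : lp p1, \forall y \near F, lp_norm (x - y) < e.
  by move=> e0; have /cauchyP/(_ e e0) [x xe] := Fc; exists x; rewrite -ball_normE in xe.
have coordB (x y : lp p1) k :
  (x : nat -> R) k - (y : nat -> R) k = ((x - y : lp p1) : nat -> R) k by [].
have ccvg k : cvg ((fun f : lp p1 => (f : nat -> R) k) @ F).
  apply/cauchy_cvgP/cauchyP => e e0; have [x xe] := Fex e e0.
  exists ((x : nat -> R) k); rewrite -ball_normE; apply: filterS xe => y /=.
  by rewrite coordB; apply: le_lt_trans; exact: lp_coord_le.
pose l k := lim ((fun f : lp p1 => (f : nat -> R) k) @ F).
have near_l (e : R) : 0 < e -> exists x : lp p1, (\forall y \near F, lp_norm (x - y) < e) /\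
    exists2 g : lp p1, (g : nat -> R) = (fun k => (x : nat -> R) k - l k) & lp_norm g <= e.
  move=> e0; have [x xe] := Fex e e0; exists x; split=> //.
  apply: lp_bounded => [|n]; first exact: ltW.
  apply: (@closed_cvg _ _ F FF
    (fun y : lp p1 => \sum_(0 <= k < n) `|(x : nat -> R) k - (y : nat -> R) k| `^ p)
    [set r | r <= e `^ p]); first exact: closed_le.
    apply: filterS xe => y /ltW xye; apply: le_trans (lp_psum_le (x - y) n) _.
    by apply: ge0_ler_powR; rewrite ?nnegrE ?lp_norm_ge0//; exact: ltW.
  apply: cvg_big => [|k _]; first exact: add_continuous.
  apply: (@cvg_comp _ _ _ (fun y : lp p1 => (x : nat -> R) k - (y : nat -> R) k)
    (fun y : R => `|y| `^ p) F (nbhs ((x : nat -> R) k - l k))); last first.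
    exact: continuous_norm_powR.
  by apply: (@cvgB R R); [exact: cvg_cst|exact: ccvg].
have [x [_ [g gE _]]] := near_l 1 ltr01.
apply/cvg_ex; exists (x - g : lp p1); apply/cvgrPdist_lt => e e0.
have e20 : 0 < e / 2 by rewrite divr_gt0.
have [y [ye [h hE he]]] := near_l (e / 2) e20.
have -> : x - g = y - h.
  apply/LfuneqP => k; transitivity (l k).
    by rewrite -[LHS]/((x : nat -> R) k - (g : nat -> R) k) gE subKr.
  by rewrite -[RHS]/((y : nat -> R) k - (h : nat -> R) k) hE subKr.
apply: filterS ye => z yz; rewrite addrAC (splitr e).
by apply: le_lt_trans (ler_normB _ _) _; apply: ltr_leD.
Qed.

HB.instance Definition _ := Uniform_isComplete.Build (lp p1) lp_complete.

End lp_banach.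

Section coarse_maps.
Context (R : realType) (X Y : completeNormedModType R).
Implicit Types (f : X -> Y) (alpha t : R).

Definition modulus f t : \bar R :=
  ereal_sup [set `|f u.1 - f u.2|%:E | u in [set u : X * X | `|u.1 - u.2| <= t]].

Definition coarse f : Prop := forall t, 0 <= t -> (modulus f t < +oo)%E.

(* [rho] is constrained only on [0, +oo[; 0 `^ 0 = 1 and 0 `^ alpha = 0 when
   alpha != 0. *)
Definition expanding_at_rate alpha f : Prop :=
  forall L : R, 0 < L ->
  exists rho : R -> R,
    [/\ forall t, 0 <= t -> 0 <= rho t,
        rho t @[t --> +oo] --> +oo &
        forall x z : X,
          L * Num.max (`|x| `^ alpha) (`|z| `^ alpha) + L <= `|x - z| ->
          rho `|x - z| <= `|f x - f z|].

End coarse_maps.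

(* Main.v *)
(* Nonexistence (with r = max(q, 2)).  Place the grid {0, ..., 2M}^N in l_p with
   mesh N^(-1/p), so that moving every coordinate by at most one mesh is a
   displacement of norm at most 1.  A metric cotype inequality with exponent r and
   M^r ~ N produces two grid points that differ only by 2M steps in one coordinate
   and whose images under a coarse map are at bounded distance.  These points are
   at distance ~ N^(1/r - 1/p) and have norm at most ~ N^(1/r), which contradicts
   expansion at rate (p - r)/p as M grows.  The inequality is proved for scalar
   functions and summed over a family of test functions: the coordinates if
   q >= 2, and cos and sin of dyadic multiples of them if q < 2, since |s - t|^q
   is then comparable to a squared Hilbert distance.

   Existence.  The homogeneous Mazur map x |-> |x|^(1 - p/q) x^(p/q) is Lipschitz
   from l_p to l_q and moves points u, v at distance t by at least a constant times
   the minimum of t and max(|u|, |v|)^(1 - p/q) t^(p/q).  If q < 2, apply this with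
   l_2 as target and compose with a coarse embedding of l_2 into l_q, a direct sum
   of Mazur images of the Gaussian embeddings
   <G x, G y> = exp(-4^(-n) |x - y|^2) into the full Fock space.  Coordinates are
   first split into positive and negative parts, so that all sums are
   nonnegative. *)
Require Import Defs.
From mathcomp Require Import all_boot all_order all_algebra.
From mathcomp Require Import all_classical all_reals all_analysis.
From mathcomp Require Import finmap ring lra.

Set Implicit Arguments.
Unset Strict Implicit.
Unset Printing Implicit Defensive.

Import Order.TTheory GRing.Theory Num.Theory.
Import numFieldNormedType.Exports.

Local Open Scope classical_set_scope.
Local Open Scope ring_scope.

(** * Nonnegative sums *)

Section nonnegative_sums.
Context (R : realType).

(** Convergence is part of the relation: the terms are nonnegative and [s] is a finite real, so
    index sets can be reindexed, split and multiplied without further summability conditions. *)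
Definition hsum (I : choiceType) (h : I -> R) (s : R) : Prop :=
  (forall i, 0 <= h i) /\ \esum_(i in [set: I]) (h i)%:E = s%:E.

Implicit Types (I J : choiceType).

Lemma hsum_unique I (h : I -> R) s t : hsum h s -> hsum h t -> s = t.
Proof. by move=> [_ hs] [_]; rewrite hs => -[]. Qed.

Lemma eq_hsum I (g h : I -> R) s : g =1 h -> hsum g s -> hsum h s.
Proof. by move=> /funext ->. Qed.

Lemma hsum_ge0 I (h : I -> R) s : hsum h s -> 0 <= s.
Proof.
move=> [h0 hs]; rewrite -lee_fin -hs; apply: esum_ge0 => i _.
by rewrite lee_fin.
Qed.

Lemma hsum_le I (g h : I -> R) s t :
  (forall i, g i <= h i) -> hsum g s -> hsum h t -> s <= t.
Proof.
move=> gh [g0 gs] [h0 ht]; rewrite -lee_fin -gs -ht.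
by apply: le_esum => i _; rewrite lee_fin.
Qed.

Lemma hsum_lty I (h : I -> R) : (forall i, 0 <= h i) ->
  (\esum_(i in [set: I]) (h i)%:E < +oo)%E -> exists s, hsum h s.
Proof.
move=> h0 hy; exists (fine (\esum_(i in [set: I]) (h i)%:E)).
split=> //; rewrite fineK// ge0_fin_numE//.
by apply: esum_ge0 => i _; rewrite lee_fin.
Qed.

Lemma hsum_dom I (g h : I -> R) t :
  (forall i, 0 <= g i) -> (forall i, g i <= h i) -> hsum h t ->
  exists2 s, hsum g s & s <= t.
Proof.
move=> g0 gh ht; have [s gs] : exists s, hsum g s.
  apply: hsum_lty => //; apply: (le_lt_trans _ (ltry t)); case: ht => _ <-.
  by apply: le_esum => i _; rewrite lee_fin.
by exists s => //; apply: hsum_le gs ht.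
Qed.

Lemma hsumD I (g h : I -> R) s t :
  hsum g s -> hsum h t -> hsum (fun i => g i + h i) (s + t).
Proof.
move=> [g0 gs] [h0 ht]; split; first by move=> i; rewrite addr_ge0.
by rewrite EFinD -gs -ht -esumD// => i _; rewrite lee_fin.
Qed.

Lemma hsum0 I : hsum (fun _ : I => 0) 0.
Proof. by split=> //; rewrite esum1. Qed.

Lemma hsum_sum I (J : Type) (r : seq J) (h : J -> I -> R) (s : J -> R) :
  (forall j, hsum (h j) (s j)) ->
  hsum (fun i => \sum_(j <- r) h j i) (\sum_(j <- r) s j).
Proof.
move=> hs; elim: r => [|j r IH].
  by rewrite big_nil; apply: eq_hsum (hsum0 I) => i; rewrite big_nil.
rewrite big_cons; apply: eq_hsum (hsumD (hs j) IH) => i.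
by rewrite big_cons.
Qed.

Lemma hsum_bound I (h : I -> R) (B : R) : (forall i, 0 <= h i) ->
  (forall r : seq I, uniq r -> \sum_(i <- r) h i <= B) ->
  exists2 s, hsum h s & s <= B.
Proof.
move=> h0 hB; have leB : (\esum_(i in [set: I]) (h i)%:E <= B%:E)%E.
  apply: ge_ereal_sup => _ [X [finX _] <-].
  by rewrite fsbig_finite// sumEFin lee_fin; apply: hB; exact: fset_uniq.
have [s hs] := hsum_lty h0 (le_lt_trans leB (ltry _)).
by exists s => //; case: hs => _ hs; rewrite -lee_fin -hs.
Qed.

Lemma hsum_seq_le I (h : I -> R) s (r : seq I) : uniq r -> hsum h s ->
  \sum_(i <- r) h i <= s.
Proof.
move=> ur [h0 hs]; rewrite -lee_fin -hs -sumEFin.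
apply: esum_ge; exists [set` r]; first by split=> //; exact: finite_seq.
by rewrite -fsbig_seq.
Qed.

Lemma hsum_term I (h : I -> R) s i : hsum h s -> h i <= s.
Proof.
move=> hs; have := @hsum_seq_le _ h s [:: i] isT hs.
by rewrite big_seq1.
Qed.

(** Bounding finite partial sums gives only an inequality; used first with [c] and then with [c^-1],
    it gives equality. *)
Lemma hsumZ I (h : I -> R) s c : 0 <= c -> hsum h s ->
  hsum (fun i => c * h i) (c * s).
Proof.
move=> c0 hs; have [h0 _] := hs.
have Z (d : R) (g : I -> R) t : 0 <= d -> hsum g t ->
    exists2 u, hsum (fun i => d * g i) u & u <= d * t.
  move=> d0 gt; have [g0 _] := gt.
  apply: hsum_bound => [i|r ur]; first by rewrite mulr_ge0.
  by rewrite -mulr_sumr ler_wpM2l// hsum_seq_le.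
have [->|cn0] := eqVneq c 0.
  by rewrite mul0r; apply: eq_hsum (hsum0 I) => i; rewrite mul0r.
have cp : 0 < c by rewrite lt_neqAle eq_sym cn0.
have [u hu uc] := Z _ _ _ c0 hs.
have ci0 : 0 <= c^-1 by rewrite invr_ge0.
have [v hv vu] := Z _ _ _ ci0 hu.
have : hsum h v by apply: eq_hsum hv => i; rewrite mulKf.
move=> /(hsum_unique hs) sv; suff -> : c * s = u by [].
apply/eqP; rewrite eq_le uc andbT mulrC -ler_pdivlMr// mulrC sv.
exact: vu.
Qed.

(** [h] is dominated by [g + h], hence summable, and additivity identifies its sum. This is how
    squared distances are obtained from inner products. *)
Lemma hsum_subr I (g h : I -> R) s t : (forall i, 0 <= h i) ->
  hsum g s -> hsum (fun i => g i + h i) t -> hsum h (t - s).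
Proof.
move=> h0 gs ght; have [g0 _] := gs.
have [u hu _] : exists2 u, hsum h u & u <= t.
  by apply: hsum_dom ght => // i; rewrite lerDr.
by rewrite -(hsum_unique (hsumD gs hu) ght) addrAC subrr add0r.
Qed.

Lemma hsum_inj I J (e : I -> J) (h : J -> R) s : injective e ->
  (forall j, (forall i, e i <> j) -> h j = 0) ->
  hsum (h \o e) s -> hsum h s.
Proof.
move=> ei hz [h0 hs].
have hp j : 0 <= h j.
  have [[i <-]|ne] := pselect (exists i, e i = j); first exact: h0.
  by rewrite hz// => i eij; apply: ne; exists i.
split=> //; rewrite -hs (esumID (range e)) //; last first.
  by move=> j _; rewrite lee_fin.
rewrite [X in (_ + X)%E]esum1 ?adde0.
  rewrite setTI esum_image; first by [].
  by move=> i j _ _; exact: ei.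
move=> j [_ nj]; rewrite hz// => i eij; apply: nj; by exists i.
Qed.

Lemma hsum_prod I J (h : I -> J -> R) (s : I -> R) t :
  (forall i, hsum (h i) (s i)) -> hsum s t ->
  hsum (fun k : I * J => h k.1 k.2) t.
Proof.
move=> hs [s0 st]; split; first by move=> [i j]; have [] := hs i.
have -> : [set: I * J] = [set: I] `*`` (fun=> [set: J]).
  by apply/seteqP; split=> x //= _; split.
rewrite -(esum_esum (a := fun i j => (h i j)%:E)); last first.
  by move=> i j _ _; rewrite lee_fin; have [] := hs i.
by rewrite -st; apply: eq_esum => i _; have [] := hs i.
Qed.

Lemma hsum_fin (I : finType) (h : I -> R) : (forall i, 0 <= h i) ->
  hsum h (\sum_i h i).
Proof.
move=> h0; split=> //.
rewrite esum_fset; last 2 first.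
- exact: finite_finset.
- by move=> i _; rewrite lee_fin.
rewrite fsbig_finite/=; last exact: finite_finset.
rewrite sumEFin; congr (_%:E).
rewrite -[RHS]big_enum; apply: perm_big; apply: uniq_perm.
- exact: fset_uniq.
- exact: enum_uniq.
move=> i; rewrite mem_enum in_fset_set; first by rewrite in_setT.
exact: finite_finset.
Qed.

(* A countable family as a sequence, padded with zeros. *)
Definition fam (I : countType) (h : I -> R) (k : nat) : R :=
  if pickle_inv k is Some i then h i else 0.

Lemma fam_pickle (I : countType) (h : I -> R) i : fam h (choice.pickle i) = h i.
Proof. by rewrite /fam pickleK_inv. Qed.

Lemma hsum_fam (I : countType) (h : I -> R) s : hsum h s -> hsum (fam h) s.
Proof.
move=> hs; apply: (@hsum_inj _ _ (@choice.pickle I)).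
- exact: (pcan_inj (@pickleK_inv I)).
- move=> j nj; rewrite /fam; case E: (pickle_inv j) => [i|//].
  by case: (nj i); have := @pickle_invK I j; rewrite /ocancel E.
by apply: eq_hsum hs => i /=; rewrite fam_pickle.
Qed.

(** The padding entries are 0, so an operation commutes with [fam] once it sends two zeros to
    zero. *)
Lemma fam2 (I : countType) (F : R -> R -> R) (g h : I -> R) : F 0 0 = 0 ->
  fam (fun i => F (g i) (h i)) =1 (fun k => F (fam g k) (fam h k)).
Proof. by move=> F0 k; rewrite /fam; case: pickle_inv. Qed.

End nonnegative_sums.

(** * Elements of l_p as summable families *)

Section lp_sums.
Context (R : realType) (p : R) (p1 : 1 <= p).

Implicit Types f g : lp p1.

Definition coord f : nat -> R := f.

Lemma coordB f g k : coord (f - g) k = coord f k - coord g k.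
Proof. by []. Qed.

Lemma lp_ext f g : coord f =1 coord g -> f = g.
Proof. by move=> fg; apply/LfuneqP => k; exact: fg. Qed.

Lemma lp_hsum f : hsum (fun k => `|coord f k| `^ p) (`|f| `^ p).
Proof.
split=> [k|]; first exact: powR_ge0.
have := lp_norm_series f; rewrite -/(coord f) => ->.
by rewrite nneseries_esumT// => k; rewrite lee_fin powR_ge0.
Qed.

Lemma lp_mem (g : nat -> R) s : hsum (fun k => `|g k| `^ p) s ->
  exists2 f, coord f = g & `|f| `^ p = s.
Proof.
move=> gs; have p0 : 0 < p by exact: lt_le_trans p1.
have s0 := hsum_ge0 gs.
have [||f fg _] := @lp_bounded _ _ p1 g (s `^ p^-1).
- exact: powR_ge0.
- move=> n; rewrite -powRrM mulVf ?gt_eqF// powRr1//.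
  by apply: hsum_seq_le gs; exact: iota_uniq.
exists f => //; apply: hsum_unique gs.
by have := lp_hsum f; rewrite /coord fg.
Qed.

End lp_sums.

(** * Powers and Walsh coefficients *)

Section powers.
Context (R : realType).

Lemma le_powR_base (x y r : R) : 0 <= r -> 0 <= x -> x <= y -> x `^ r <= y `^ r.
Proof.
by move=> r0 x0 xy; apply: ge0_ler_powR; rewrite ?nnegrE//; exact: le_trans xy.
Qed.

Lemma powR_ge1 (x r : R) : 0 <= r -> 1 <= x -> 1 <= x `^ r.
Proof. by move=> r0 x1; have := le_powR_base r0 ler01 x1; rewrite powR1. Qed.

Lemma powR_le1 (x r : R) : 0 <= r -> 0 <= x -> x <= 1 -> x `^ r <= 1.
Proof. by move=> r0 x0 x1; have := le_powR_base r0 x0 x1; rewrite powR1. Qed.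

(** Young's inequality for the product [u * 1] with exponent [s] and its conjugate [(1 - s^-1)^-1],
    multiplied by [s]. *)
Lemma powR_bernoulli (u s : R) : 0 <= u -> 1 <= s -> 1 + s * (u - 1) <= u `^ s.
Proof.
move=> u0; rewrite le_eqVlt => /predU1P[<-|s1].
  by rewrite powRr1// mul1r addrC subrK.
have s0 : 0 < s by exact: lt_trans s1.
have s'0 : 0 < (1 - s^-1)^-1 by rewrite invr_gt0 subr_gt0 invf_lt1.
have := @conjugate_powR _ u 1 s _ u0 ler01 s0 s'0.
rewrite invrK (addrC s^-1) subrK => /(_ erefl).
rewrite mulr1 powR1 mul1r => h.
have : s * u <= s * (u `^ s / s + (1 - s^-1)) by rewrite ler_wpM2l// ltW.
have -> : s * (u `^ s / s + (1 - s^-1)) = u `^ s + s - 1.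
  by field; rewrite gt_eqF.
by rewrite mulrBr mulr1; lra.
Qed.

(** Jensen's inequality: the tangent bound at the mean [m] is summed, and the linear terms
    cancel. *)
Lemma sum_powR_le (I : Type) (r : seq I) (a : I -> R) (s : R) :
  (forall i, 0 <= a i) -> 1 <= s ->
  (\sum_(i <- r) a i) `^ s <= (size r)%:R `^ (s - 1) * \sum_(i <- r) a i `^ s.
Proof.
move=> a0 s1; have s0 : 0 < s by exact: lt_le_trans s1.
set S := \sum_(i <- r) a i.
have S0 : 0 <= S by exact: sumr_ge0.
have := S0; rewrite le_eqVlt => /predU1P[<-|Sp].
  by rewrite powR0 ?gt_eqF// mulr_ge0 ?powR_ge0//; apply: sumr_ge0 => i _; exact: powR_ge0.
have n0 : 0 < (size r)%:R :> R.
  rewrite ltr0n lt0n; apply/eqP => /size0nil r0.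
  by move: Sp; rewrite /S r0 big_nil ltxx.
set n := (size r)%:R in n0 *; pose m := S / n.
have m0 : 0 < m by rewrite divr_gt0.
have tangent i : m `^ s * (1 + s * (a i / m - 1)) <= a i `^ s.
  have -> : a i `^ s = m `^ s * (a i / m) `^ s.
    rewrite -powRM; [|exact: ltW|by rewrite divr_ge0// ltW].
    by rewrite mulrC divfK// gt_eqF.
  by rewrite ler_wpM2l ?powR_ge0// powR_bernoulli// divr_ge0// ltW.
have : m `^ s * n <= \sum_(i <- r) a i `^ s.
  apply: le_trans (ler_sum _ (fun i _ => tangent i)).
  rewrite (eq_bigr (fun i => m `^ s * ((1 - s) + s / m * a i))); last by move=> i _; ring.
  rewrite -mulr_sumr big_split/= -mulr_sumr -/S big_const_seq count_predT iter_addr_0.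
  rewrite -[in leRHS]mulr_natr -/n le_eqVlt; apply/orP; left; apply/eqP; congr (_ * _).
  by rewrite /m; field; rewrite !gt_eqF.
move=> /(ler_wpM2l (powR_ge0 n (s - 1))); apply: le_trans.
rewrite le_eqVlt; apply/orP; left; apply/eqP.
rewrite mulrCA -{2}(powRr1 (ltW n0)) -powRD; last by rewrite (gt_eqF n0) implybT.
rewrite subrK.
rewrite -powRM; [|exact: ltW|exact: ltW].
by rewrite divfK// gt_eqF.
Qed.


Lemma powR_norm_sum_le (I : Type) (r : seq I) (a : I -> R) (s : R) : 1 <= s ->
  `|\sum_(i <- r) a i| `^ s
    <= (size r)%:R `^ (s - 1) * \sum_(i <- r) `|a i| `^ s.
Proof.
move=> s1; have s0 : 0 <= s by exact: le_trans s1.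
apply: le_trans (sum_powR_le r (fun i => normr_ge0 (a i)) s1).
by rewrite ge0_ler_powR ?nnegrE ?ler_norm_sum// sumr_ge0.
Qed.

Lemma powR_norm2E (x s : R) : `|x| `^ s = (x ^+ 2) `^ (s / 2).
Proof.
rewrite -(real_normK (num_real x)) -powR_mulrn// -powRrM.
by congr (_ `^ _); rewrite mulrC divfK.
Qed.

End powers.

Section scalar_powers.
Context (R : realType).
Implicit Types a b s : R.

Lemma powR_superadd a b s : 0 <= a -> 0 <= b -> 1 <= s ->
  a `^ s + b `^ s <= (a + b) `^ s.
Proof.
move=> a0 b0 s1; have s0 : 0 < s by exact: lt_le_trans s1.
rewrite -(mulr_powRB1 a0 s0) -(mulr_powRB1 b0 s0) -(mulr_powRB1 (addr_ge0 a0 b0) s0).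
by rewrite mulrDl lerD// ler_wpM2l// le_powR_base ?subr_ge0 ?lerDl ?lerDr.
Qed.

Lemma powR_add_le a b s : 0 <= a -> 0 <= b -> 1 <= s ->
  (a + b) `^ s <= 2 `^ s * (a `^ s + b `^ s).
Proof.
move=> a0 b0 s1; have ab0 : 0 <= a `^ s + b `^ s by rewrite addr_ge0 ?powR_ge0.
have := @sum_powR_le _ _ [:: true; false] (fun i : bool => if i then a else b) s.
rewrite !big_cons !big_nil/= !addr0 => /(_ _ s1)/le_trans; apply.
  by case.
rewrite ler_wpM2r// ler_powR ?ler1n//.
by rewrite gerBl ler01.
Qed.

Lemma dist_powR_ge a b s : 0 <= a -> 0 <= b -> 1 <= s ->
  `|a - b| `^ s <= `|a `^ s - b `^ s|.
Proof.
move=> a0 b0 s1; have s0 : 0 <= s by exact: le_trans s1.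
wlog ba : a b a0 b0 / b <= a => [H|].
  have [ba|/ltW ab] := leP b a; first exact: H.
  by rewrite (distrC a) (distrC (a `^ _)); exact: H.
rewrite !ger0_norm ?subr_ge0//; last exact: le_powR_base.
rewrite lerBrDr; apply: le_trans (powR_superadd _ _ s1) _; rewrite ?subr_ge0//.
by rewrite subrK.
Qed.

(** A mean value estimate without derivatives: Bernoulli's inequality at the ratio [b / a], for
    [b <= a]. *)
Lemma dist_powR_le a b s : 0 <= a -> 0 <= b -> 1 <= s ->
  `|a `^ s - b `^ s| <= s * `|a - b| * Num.max a b `^ (s - 1).
Proof.
move=> a0 b0 s1; have s0 : 0 < s by exact: lt_le_trans s1.
wlog ba : a b a0 b0 / b <= a => [H|].
  have /orP[ba|ab] := le_total b a; first exact: H.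
  by rewrite (distrC a) (distrC (a `^ _)) (maxC a); exact: H.
rewrite max_l// !ger0_norm ?subr_ge0//; last exact: le_powR_base (ltW s0) b0 ba.
have := a0; rewrite le_eqVlt => /predU1P[a00|ap].
  have b00 : b = 0 by apply/eqP; rewrite eq_le b0 a00 ba.
  by rewrite b00 -a00 subrr mulr_ge0// ?powR_ge0// subrr mulr0.
have h := powR_bernoulli (divr_ge0 b0 a0) s1.
have -> : b `^ s = a `^ s * (b / a) `^ s.
  by rewrite -powRM ?divr_ge0// mulrC divfK// gt_eqF.
rewrite -(mulr_powRB1 a0 s0); set w := a `^ (s - 1).
apply: le_trans (_ : a * w - a * w * (1 + s * (b / a - 1)) <= _).
  by rewrite lerD2l lerN2 ler_wpM2l// mulr_ge0// powR_ge0.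
by rewrite le_eqVlt; apply/orP; left; apply/eqP; field; rewrite gt_eqF.
Qed.

(** Splitting into positive and negative parts embeds the line isometrically into the plane with the
    l_1 norm. *)
Lemma dist_posnegE (x y : R) :
  `|Num.max 0 x - Num.max 0 y| + `|Num.max 0 (- x) - Num.max 0 (- y)| = `|x - y|.
Proof.
have pn (z : R) : [/\ 0 <= Num.max 0 z, 0 <= Num.max 0 (- z),
    z = Num.max 0 z - Num.max 0 (- z) & Num.max 0 z = 0 \/ Num.max 0 (- z) = 0].
  have [z0|z0] := leP 0 z.
    by rewrite max_l ?oppr_le0// subr0; split=> //; right.
  have nz : 0 <= - z by rewrite oppr_ge0 ltW.
  by rewrite (max_r nz) sub0r opprK; split=> //; left.
have [] := pn x; have [] := pn y.
set a := Num.max 0 y; set b := Num.max 0 (- y).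
set c := Num.max 0 x; set d := Num.max 0 (- x) => a0 b0 yE ab c0 d0 xE cd.
case: (ger0P (c - a)) => ?; case: (ger0P (d - b)) => ?; case: (ger0P (x - y)) => ?;
  case: ab => ?; case: cd => ?; lra.
Qed.

Lemma powR_le_cancel a b s : 0 < s -> 0 <= a -> 0 <= b ->
  a `^ s <= b `^ s -> a <= b.
Proof.
move=> s0 a0 b0; rewrite leNgt => /negP ab; rewrite leNgt; apply/negP => ba.
by apply: ab; apply: gt0_ltr_powR.
Qed.

End scalar_powers.

Section walsh.
Context (R : realType) (N : nat).
Implicit Types (d : {ffun 'I_N -> bool}) (j k : 'I_N).

Definition sg d j : R := (-1) ^+ d j.

Definition flip j d : {ffun 'I_N -> bool} := [ffun i => d i (+) (i == j)].

Lemma flipK j : involutive (flip j).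
Proof. by move=> d; apply/ffunP => i; rewrite !ffunE addbK. Qed.

Lemma sg_flip j d i : sg (flip j d) i = if i == j then - sg d i else sg d i.
Proof.
by rewrite /sg ffunE; case: (i == j); case: (d i); rewrite /= ?expr0 ?expr1 ?opprK.
Qed.

Lemma sum_flip (g : {ffun 'I_N -> bool} -> R) j :
  \sum_d g (flip j d) = \sum_d g d.
Proof. by rewrite [RHS](reindex_inj (inv_inj (flipK j))). Qed.

Lemma sum_sg j : \sum_d sg d j = 0.
Proof.
have : \sum_d sg (flip j d) j = - \sum_d sg d j.
  by rewrite -sumrN; apply: eq_bigr => d _; rewrite sg_flip eqxx.
by rewrite (sum_flip (fun d => sg d j)) => h; lra.
Qed.

Lemma sum_sgM j k :
  \sum_d sg d j * sg d k = (2 ^ N)%:R * (j == k)%:R.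
Proof.
have [<-|jk] := eqVneq j k.
  rewrite mulr1 (eq_bigr (fun=> 1)).
    by rewrite sumr_const card_ffun card_bool card_ord.
  by move=> d _; rewrite -signr_addb addbb.
have : \sum_d sg (flip j d) j * sg (flip j d) k = - \sum_d sg d j * sg d k.
  rewrite -sumrN; apply: eq_bigr => d _.
  by rewrite !sg_flip eqxx (negPf (_ : k != j)) 1?eq_sym// mulNr.
by rewrite (sum_flip (fun d => sg d j * sg d k)) mulr0 => h; lra.
Qed.

(** The functions [sg _ j] are orthogonal with squared norm [K = 2 ^ N]; the claim is the
    nonnegativity of the squared distance from [K * g] to its projection, expanded. *)
Lemma walsh_bessel (g : {ffun 'I_N -> bool} -> R) :
  \sum_j (\sum_d sg d j * g d) ^+ 2 <= (2 ^ N)%:R * \sum_d g d ^+ 2.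
Proof.
pose c j := \sum_d sg d j * g d; pose K : R := (2 ^ N)%:R.
have K0 : 0 < K by rewrite ltr0n expn_gt0.
have : 0 <= \sum_d (K * g d - \sum_j c j * sg d j) ^+ 2.
  by apply: sumr_ge0 => d _; exact: sqr_ge0.
have -> : \sum_d (K * g d - \sum_j c j * sg d j) ^+ 2 =
    K * (K * \sum_d g d ^+ 2 - \sum_j c j ^+ 2).
  under eq_bigr do rewrite sqrrB.
  rewrite big_split/= sumrB.
  have -> : \sum_d (\sum_j c j * sg d j) ^+ 2 = K * \sum_j c j ^+ 2.
    under eq_bigr do rewrite expr2 big_distrlr/=.
    rewrite exchange_big/= mulr_sumr; apply: eq_bigr => j _.
    rewrite exchange_big/= (bigD1 j)//= [X in _ + X]big1 ?addr0 => [|k kj].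
      under eq_bigr do rewrite mulrACA.
      by rewrite -mulr_sumr sum_sgM eqxx mulr1 mulrC expr2.
    under eq_bigr do rewrite mulrACA.
    by rewrite -mulr_sumr sum_sgM eq_sym (negPf kj) !mulr0.
  have -> : \sum_d (K * g d * \sum_j c j * sg d j) *+ 2 = 2 * K * \sum_j c j ^+ 2.
    under eq_bigr do rewrite -mulr_natl mulrA mulr_sumr.
    rewrite exchange_big/= mulr_sumr; apply: eq_bigr => j _.
    transitivity (2 * K * c j * \sum_d sg d j * g d); last by rewrite -/(c j); ring.
    by rewrite mulr_sumr; apply: eq_bigr => d _; ring.
  have -> : \sum_d (K * g d) ^+ 2 = K * (K * \sum_d g d ^+ 2).
    rewrite mulrA mulr_sumr; apply: eq_bigr => d _; ring.
  ring.
by rewrite pmulr_rge0// subr_ge0.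
Qed.

(* For [r >= 2], Bessel's inequality and [l_2 -> l_r] contractivity replace the
   K-convexity used for general targets. *)
Lemma walsh_powR (g : {ffun 'I_N -> bool} -> R) (r : R) : 2 <= r ->
  \sum_j `|\sum_d sg d j * g d| `^ r
    <= (2 ^ N)%:R `^ (r - 1) * \sum_d `|g d| `^ r.
Proof.
move=> r2; set c := fun j => \sum_d sg d j * g d.
set K : R := (2 ^ N)%:R; have K0 : 0 < K by rewrite ltr0n expn_gt0.
pose S := K * \sum_d g d ^+ 2.
have S0 : 0 <= S.
  by apply: mulr_ge0; [exact: ltW|apply: sumr_ge0 => d _; exact: sqr_ge0].
have cS : \sum_j c j ^+ 2 <= S by exact: walsh_bessel.
have s1 : 1 <= r / 2 by lra.
have s0 : 0 < r / 2 by lra.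
(* Since [c j ^+ 2 <= S], one factor [c j ^+ 2] is kept and the remaining power is replaced by that
   of [S]; the sum over [j] is then at most [S] to the power [r / 2]. *)
have cj j : `|c j| `^ r <= c j ^+ 2 * S `^ (r / 2 - 1).
  rewrite powR_norm2E -mulr_powRB1 ?sqr_ge0// ler_wpM2l ?sqr_ge0//.
  apply: ge0_ler_powR; rewrite ?nnegrE ?sqr_ge0//; first by lra.
  apply: le_trans cS; rewrite (bigD1 j)//= lerDl.
  by apply: sumr_ge0 => k _; exact: sqr_ge0.
apply: le_trans (ler_sum _ (fun j _ => cj j)) _.
rewrite -mulr_suml; apply: le_trans (_ : S `^ (r / 2) <= _).
  by rewrite -[leRHS]mulr_powRB1// ler_wpM2r ?powR_ge0.
have /= := @sum_powR_le _ _ (enum {ffun 'I_N -> bool}) (fun d => g d ^+ 2) (r / 2)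
  (fun d => sqr_ge0 _) s1.
rewrite !big_enum/= -cardE card_ffun card_bool card_ord -/K => h.
rewrite powRM; [|exact: ltW|by apply: sumr_ge0 => d _; exact: sqr_ge0].
apply: le_trans (ler_wpM2l (powR_ge0 _ _) h) _.
rewrite mulrA -powRD; last by rewrite (gt_eqF K0) implybT.
have -> : r / 2 + (r / 2 - 1) = r - 1 by lra.
rewrite ler_wpM2l ?powR_ge0// ler_sum// => d _.
by rewrite powR_norm2E.
Qed.

End walsh.

(** * Metric cotype on a grid *)

Section grid_cotype.
Context (R : realType) (N M : nat).
Implicit Types (x : {ffun 'I_N -> 'I_M}) (d : {ffun 'I_N -> bool}) (j : 'I_N).

(** Grid points have odd coordinates from 1 to 2M - 1, so a unit shift leads to an even coordinate
    from 0 to 2M, shared by neighbouring grid points. *)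
Definition pt x : 'I_N -> R := fun i => (2 * x i + 1)%:R.

Definition upd (z : 'I_N -> R) j (a : R) : 'I_N -> R :=
  fun i => if i == j then a else z i.

Definition shift (z : 'I_N -> R) d : 'I_N -> R := fun i => z i + sg R d i.

Definition setx x j (s : 'I_M) : {ffun 'I_N -> 'I_M} :=
  [ffun i => if i == j then s else x i].

(** Exchanging [s] with the [j]-th coordinate of [x] is an involution on pairs, so every point is
    counted [M] times. *)
Lemma sum_setx (phi : {ffun 'I_N -> 'I_M} -> R) j :
  \sum_x \sum_s phi (setx x j s) = M%:R * \sum_x phi x.
Proof.
rewrite pair_big/=.
pose e (u : {ffun 'I_N -> 'I_M} * 'I_M) := (setx u.1 j u.2, u.1 j).
have ei : involutive e.
  move=> [x s]; rewrite /e /=; congr (_, _); last by rewrite ffunE eqxx.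
  by apply/ffunP => i; rewrite !ffunE; case: eqP => // ->.
rewrite (reindex_inj (inv_inj ei))/=.
rewrite (eq_bigr (fun u => phi u.1)) => [|[x s] _].
  rewrite -(pair_bigA _ (fun x (s : 'I_M) => phi x))/= mulr_sumr.
  by apply: eq_bigr => x _; rewrite sumr_const card_ord mulr_natl.
rewrite /e /=; congr phi.
by apply/ffunP => i; rewrite !ffunE; case: eqP => // ->.
Qed.

Variable h : ('I_N -> R) -> R.

(* [2 ^ N] times the average over the sign vectors [d], acting off [j]. *)
Definition avg x j (a : R) : R := \sum_d h (upd (shift (pt x) d) j a).

Lemma avg_setx x j s a : avg (setx x j s) j a = avg x j a.
Proof.
apply: eq_bigr => d _; congr h; apply/funext => i.
by rewrite /upd /shift /pt; case: eqP => // /eqP ij; rewrite ffunE (negPf ij).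
Qed.

(* Level-one Walsh coefficients are increments of the smoothed function. *)
Lemma walsh_avg x j :
  2 * \sum_d sg R d j * (h (shift (pt x) d) - h (pt x)) =
  avg x j (2 * x j + 2)%:R - avg x j (2 * x j)%:R.
Proof.
have -> : \sum_d sg R d j * (h (shift (pt x) d) - h (pt x)) =
    \sum_d sg R d j * h (shift (pt x) d).
  under eq_bigr do rewrite mulrBr.
  by rewrite sumrB -mulr_suml sum_sg mul0r subr0.
(* The second copy of the sum is reindexed by [flip j]: each [d] is paired with its flip, and the
   two move coordinate [j] up and down by 1. *)
rewrite mulr_natl mulr2n -{2}(sum_flip _ j) -big_split/= /avg -sumrB.
apply: eq_bigr => d _; rewrite sg_flip eqxx mulNr -mulrBr.
have up : shift (pt x) (if d j then flip j d else d) =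
    upd (shift (pt x) d) j (2 * x j + 2)%:R.
  apply/funext => i; rewrite /upd /shift; case: eqP => [->|/eqP ij].
    have -> : sg R (if d j then flip j d else d) j = 1.
      rewrite /sg; case E: (d j); last by rewrite E.
      by rewrite ffunE E eqxx.
    by rewrite /pt natr1 -addnS.
  by case: (d j); rewrite // sg_flip (negPf ij).
have dn : shift (pt x) (if d j then d else flip j d) =
    upd (shift (pt x) d) j (2 * x j)%:R.
  apply/funext => i; rewrite /upd /shift; case: eqP => [->|/eqP ij].
    have -> : sg R (if d j then d else flip j d) j = -1.
      rewrite /sg; case E: (d j); first by rewrite E.
      by rewrite ffunE E eqxx.
    by rewrite /pt natrD addrK.
  by case: (d j); rewrite // sg_flip (negPf ij).
by rewrite -up -dn {1}/sg; case: (d j); rewrite ?mul1r ?mulN1r ?opprB.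
Qed.

(** Along a line in direction [j] the upper end of one step is the lower end of the next, and [avg]
    in direction [j] ignores the [j]-th coordinate of its point. *)
Lemma telescope_avg x j :
  avg x j (2 * M)%:R - avg x j 0 = \sum_(s < M)
    2 * \sum_d sg R d j * (h (shift (pt (setx x j s)) d) - h (pt (setx x j s))).
Proof.
under eq_bigr do rewrite walsh_avg !avg_setx ffunE eqxx.
rewrite -(big_mkord xpredT (fun s => avg x j (2 * s + 2)%:R - avg x j (2 * s)%:R)).
rewrite (eq_bigr (fun s => avg x j (2 * s.+1)%:R - avg x j (2 * s)%:R)).
  by rewrite (telescope_sumr (fun s => avg x j (2 * s)%:R))// muln0.
by move=> s _; rewrite mulnS addnC.
Qed.

Variable r : R.
Hypothesis r2 : 2 <= r.

Let K : R := (2 ^ N)%:R.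
Let K0 : 0 < K. Proof. by rewrite ltr0n expn_gt0. Qed.

(** Convexity over the [M] telescoping terms costs [M ^ (r - 1)], the sum over [s] costs a factor
    [M], and the 2 in [walsh_avg] costs [2 ^ r]: together [(2 * M) ^ r]. The Walsh coefficients are
    then bounded at each grid point separately. *)
Lemma sum_avg_le :
  \sum_j \sum_x `|avg x j (2 * M)%:R - avg x j 0| `^ r <=
  (2 * M)%:R `^ r * (K `^ (r - 1) *
    \sum_x \sum_d `|h (shift (pt x) d) - h (pt x)| `^ r).
Proof.
have r1 : 1 <= r by apply: le_trans r2; rewrite ler1n.
have r0 : 0 < r by exact: lt_le_trans r1.
pose c x j := \sum_d sg R d j * (h (shift (pt x) d) - h (pt x)).
have step j : \sum_x `|avg x j (2 * M)%:R - avg x j 0| `^ r <=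
    (2 * M)%:R `^ r * \sum_x `|c x j| `^ r.
  have stepx x : `|avg x j (2 * M)%:R - avg x j 0| `^ r <=
      M%:R `^ (r - 1) * \sum_s 2 `^ r * `|c (setx x j s) j| `^ r.
    rewrite telescope_avg.
    apply: le_trans (powR_norm_sum_le _ _ r1) _.
    rewrite -[X in size X]enumT size_enum_ord ler_wpM2l ?powR_ge0//.
    by apply: ler_sum => s _; rewrite normrM powRM// ger0_norm.
  apply: le_trans (ler_sum _ (fun x _ => stepx x)) _.
  rewrite -mulr_sumr.
  under eq_bigr do rewrite -mulr_sumr.
  rewrite -mulr_sumr (sum_setx (fun x => `|c x j| `^ r)) natrM powRM//.
  rewrite -[in leRHS](mulr_powRB1 (ler0n R M) r0).
  by rewrite le_eqVlt; apply/orP; left; apply/eqP; ring.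
apply: le_trans (ler_sum _ (fun j _ => step j)) _.
rewrite -mulr_sumr ler_wpM2l ?powR_ge0// exchange_big/= mulr_sumr.
by apply: ler_sum => x _; exact: walsh_powR.
Qed.

(* Metric cotype [r] for scalar functions: only the exponent matters later, when
   the inequality is summed over the coordinates of a vector-valued map. *)
Lemma grid_cotype :
  K * \sum_j \sum_x `|h (upd (pt x) j (2 * M)%:R) - h (upd (pt x) j 0)| `^ r <=
  3 `^ (r - 1) *
  (\sum_j \sum_x \sum_d
     `|h (upd (pt x) j (2 * M)%:R) - h (upd (shift (pt x) d) j (2 * M)%:R)| `^ r +
   \sum_j \sum_x \sum_d
     `|h (upd (shift (pt x) d) j 0) - h (upd (pt x) j 0)| `^ r +
   (2 * M)%:R `^ r * \sum_x \sum_d `|h (shift (pt x) d) - h (pt x)| `^ r).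
Proof.
have r1 : 1 <= r by apply: le_trans r2; rewrite ler1n.
have r0 : 0 < r by exact: lt_le_trans r1.
have Kr : 0 < K `^ (r - 1) by exact: powR_gt0.
have avgE x j a : K * h (upd (pt x) j a) =
    \sum_(d : {ffun 'I_N -> bool}) h (upd (pt x) j a).
  by rewrite sumr_const card_ffun card_bool card_ord mulr_natl.
have sK (a : {ffun 'I_N -> bool} -> R) :
    `|\sum_d a d| `^ r <= K `^ (r - 1) * \sum_d `|a d| `^ r.
  have /= := @powR_norm_sum_le _ _ (enum {ffun 'I_N -> bool}) a r r1.
  by rewrite !big_enum/= -cardE card_ffun card_bool card_ord.
pose S1 x j := \sum_d
  `|h (upd (pt x) j (2 * M)%:R) - h (upd (shift (pt x) d) j (2 * M)%:R)| `^ r.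
pose S2 x j := \sum_d `|h (upd (shift (pt x) d) j 0) - h (upd (pt x) j 0)| `^ r.
(* Both endpoint values are compared with their averages over [d]; the increment is a sum of three
   terms, whence [3 ^ (r - 1)]. *)
have step x j :
    K `^ r * `|h (upd (pt x) j (2 * M)%:R) - h (upd (pt x) j 0)| `^ r <=
    3 `^ (r - 1) * (K `^ (r - 1) * S1 x j +
      K `^ (r - 1) * S2 x j + `|avg x j (2 * M)%:R - avg x j 0| `^ r).
  rewrite -{1}(ger0_norm (ltW K0)) -powRM// -normrM mulrBr.
  set u := K * h _; set v := K * h _.
  have -> : u - v = \sum_(i < 3) [:: u - avg x j (2 * M)%:R; avg x j 0 - v;
      avg x j (2 * M)%:R - avg x j 0]`_i.
    by rewrite !big_ord_recl big_ord0/=; ring.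
  apply: le_trans (powR_norm_sum_le _ _ r1) _.
  rewrite -[X in size X]enumT size_enum_ord ler_wpM2l ?powR_ge0//.
  rewrite !big_ord_recl big_ord0/= addr0 addrA lerD2r.
  by apply: lerD; rewrite /u /v avgE /avg -sumrB; exact: sK.
rewrite -(ler_pM2l Kr) mulrA (mulrC (K `^ _)) (mulr_powRB1 (ltW K0) r0).
rewrite mulr_sumr; under eq_bigr do rewrite mulr_sumr.
apply: le_trans (ler_sum _ (fun j _ => ler_sum _ (fun x _ => step x j))) _.
under eq_bigr do rewrite -mulr_sumr !big_split/= -!mulr_sumr.
rewrite -mulr_sumr !big_split/= -!mulr_sumr mulrCA ler_wpM2l ?powR_ge0//.
rewrite !mulrDr lerD2l; apply: le_trans sum_avg_le _.
by rewrite mulrCA.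
Qed.

End grid_cotype.

Section family_cotype.
Context (R : realType) (N M : nat) (I : choiceType).
Variables (h : I -> ('I_N -> R) -> R) (S : ('I_N -> R) -> ('I_N -> R) -> R).
Variables (r A B : R).

(** Summing [grid_cotype] over [I] turns scalar differences into [S]. Every term on the right is at
    most [A], and the common factor [K * X], the number of pairs of a sign vector and a grid point,
    cancels. *)
Lemma family_cotype : (0 < M)%N -> 2 <= r ->
  (forall z w, hsum (fun i => `|h i z - h i w| `^ r) (S z w)) ->
  (forall z w, (forall i, `|z i - w i| <= 1) -> S z w <= A) ->
  (forall (x : {ffun 'I_N -> 'I_M}) j,
     B <= S (upd (pt R x) j (2 * M)%:R) (upd (pt R x) j 0)) ->
  N%:R * B <= 3 `^ (r - 1) * (2 * N%:R + (2 * M)%:R `^ r) * A.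
Proof.
move=> M0 r2 hS SA SB; pose K : R := (2 ^ N)%:R; pose X : R := (M ^ N)%:R.
have K0 : 0 < K by rewrite ltr0n expn_gt0.
have X0 : 0 < X by rewrite ltr0n expn_gt0 M0.
have cardX (c : R) : \sum_(x : {ffun 'I_N -> 'I_M}) c = X * c.
  by rewrite sumr_const card_ffun !card_ord mulr_natl.
have cardK (c : R) : \sum_(d : {ffun 'I_N -> bool}) c = K * c.
  by rewrite sumr_const card_ffun card_bool card_ord mulr_natl.
have cardN (c : R) : \sum_(j < N) c = N%:R * c.
  by rewrite sumr_const card_ord mulr_natl.
have L : hsum (fun i => K * \sum_(j < N) \sum_(x : {ffun 'I_N -> 'I_M})
      `|h i (upd (pt R x) j (2 * M)%:R) - h i (upd (pt R x) j 0)| `^ r)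
    (K * \sum_(j < N) \sum_(x : {ffun 'I_N -> 'I_M})
       S (upd (pt R x) j (2 * M)%:R) (upd (pt R x) j 0)).
  by apply: hsumZ; [exact: ltW|do 2 apply: hsum_sum => ?; exact: hS].
have Rs := hsumZ (powR_ge0 3 (r - 1)) (hsumD (hsumD
  (hsum_sum (index_enum 'I_N) (fun j => hsum_sum (index_enum {ffun 'I_N -> 'I_M})
    (fun x => hsum_sum (index_enum {ffun 'I_N -> bool}) (fun d =>
      hS (upd (pt R x) j (2 * M)%:R) (upd (shift (pt R x) d) j (2 * M)%:R)))))
  (hsum_sum (index_enum 'I_N) (fun j => hsum_sum (index_enum {ffun 'I_N -> 'I_M})
    (fun x => hsum_sum (index_enum {ffun 'I_N -> bool}) (fun d =>
      hS (upd (shift (pt R x) d) j 0) (upd (pt R x) j 0))))))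
  (hsumZ (powR_ge0 (2 * M)%:R r) (hsum_sum (index_enum {ffun 'I_N -> 'I_M})
    (fun x => hsum_sum (index_enum {ffun 'I_N -> bool}) (fun d =>
      hS (shift (pt R x) d) (pt R x)))))).
have := hsum_le (fun i => grid_cotype M (h i) r2) L Rs.
have sg1 (d : {ffun 'I_N -> bool}) i : `|sg R d i| = 1 by rewrite normr_sign.
have b1 (x : {ffun 'I_N -> 'I_M}) d : S (shift (pt R x) d) (pt R x) <= A.
  by apply: SA => i; rewrite /shift addrC addKr sg1.
have b2 (x : {ffun 'I_N -> 'I_M}) d j a :
    S (upd (shift (pt R x) d) j a) (upd (pt R x) j a) <= A.
  apply: SA => i; rewrite /shift /upd; case: eqP => _; first by rewrite subrr normr0.
  by rewrite addrC addKr sg1.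
have b3 (x : {ffun 'I_N -> 'I_M}) d j a :
    S (upd (pt R x) j a) (upd (shift (pt R x) d) j a) <= A.
  apply: SA => i; rewrite /shift /upd; case: eqP => _; first by rewrite subrr normr0.
  by rewrite opprD addNKr normrN sg1.
move=> hle; rewrite -(ler_pM2l K0) -(ler_pM2l X0).
apply: le_trans (_ : K * (N%:R * (X * B)) <= _).
  by rewrite le_eqVlt; apply/orP; left; apply/eqP; ring.
apply: le_trans (_ : 3 `^ (r - 1) * (N%:R * (X * (K * A)) + N%:R * (X * (K * A)) +
   (2 * M)%:R `^ r * (X * (K * A))) <= _); last first.
  by rewrite le_eqVlt; apply/orP; left; apply/eqP; ring.
suff hB : K * (N%:R * (X * B)) <= K * \sum_(j < N) \sum_(x : {ffun 'I_N -> 'I_M})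
    S (upd (pt R x) j (2 * M)%:R) (upd (pt R x) j 0).
  apply: (le_trans hB); apply: (le_trans hle).
  rewrite ler_wpM2l ?powR_ge0// lerD ?lerD//.
  - rewrite -cardN ler_sum// => j _; rewrite -cardX ler_sum// => x _.
    by rewrite -cardK ler_sum// => d _; exact: b3.
  - rewrite -cardN ler_sum// => j _; rewrite -cardX ler_sum// => x _.
    by rewrite -cardK ler_sum// => d _; exact: b2.
  - rewrite ler_wpM2l ?powR_ge0// -cardX ler_sum// => x _.
    by rewrite -cardK ler_sum// => d _; exact: b1.
rewrite ler_pM2l// -cardN ler_sum// => j _; rewrite -cardX ler_sum// => x _.
Qed.

End family_cotype.

(** * Finite-dimensional vectors in l_p *)

Section grid_in_lp.
Context (R : realType) (p : R) (p1 : 1 <= p).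

Lemma vec_in_lp (N : nat) : exists V : ('I_N -> R) -> lp p1,
  (forall z, `|V z| `^ p = \sum_i `|z i| `^ p) /\
  (forall z w, `|V z - V w| `^ p = \sum_i `|z i - w i| `^ p).
Proof.
pose e (z : 'I_N -> R) k := if insub k is Some i then z i else 0.
have p0 : p != 0 by rewrite gt_eqF// (lt_le_trans ltr01 p1).
have es z : hsum (fun k => `|e z k| `^ p) (\sum_i `|z i| `^ p).
  apply: (@hsum_inj _ _ _ (@nat_of_ord N)); first exact: val_inj.
  - move=> k kN; rewrite /e; case: insubP => [i _ ik|_].
      by case: (kN i).
    by rewrite normr0 powR0.
  - apply: eq_hsum (hsum_fin (fun i => powR_ge0 _ _)) => i /=.
    by rewrite /e valK.
have V z : {f : lp p1 | coord f = e z & `|f| `^ p = \sum_i `|z i| `^ p}.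
  by apply: cid2; exact: lp_mem.
exists (fun z => s2val (V z)); split=> [z|z w]; first exact: (s2valP' (V z)).
have := s2valP' (V (fun i => z i - w i)); move=> <-; congr (`|_| `^ _).
apply: lp_ext => k; rewrite coordB !(s2valP (V _)) /e.
by case: insub => //; rewrite subr0.
Qed.

End grid_in_lp.

(** * Coarseness and expansion as uniform bounds *)

Section coarse_bound.
Context (R : realType) (X Y : completeNormedModType R).

Lemma coarseP (f : X -> Y) : coarse f <->
  forall t, 0 <= t -> exists A, forall x y, `|x - y| <= t -> `|f x - f y| <= A.
Proof.
split=> fc t t0.
  have := fc t t0; rewrite /modulus; set S := [set _ | _ in _] => Sy.
  have S0 : (0 <= ereal_sup S)%E.
    apply: ereal_sup_ubound; exists (0, 0); last by rewrite !subrr normr0.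
    by rewrite /= subrr normr0.
  exists (fine (ereal_sup S)) => x y xy.
  rewrite -lee_fin fineK ?ge0_fin_numE//; apply: ereal_sup_ubound.
  by exists (x, y).
have [A fA] := fc t t0; apply: (@le_lt_trans _ _ A%:E); last exact: ltry.
by apply: ge_ereal_sup => _ [[x y] /= xy <-]; rewrite lee_fin; exact: fA.
Qed.

(** For the converse, [rho t] is the infimum of the image distances over admissible pairs at
    distance at least [t]; [t] itself is adjoined so that the set is never empty. *)
Lemma expanding_at_rateP alpha (f : X -> Y) : expanding_at_rate alpha f <->
  forall L B : R, 0 < L -> exists T : R, forall x z,
    L * Num.max (`|x| `^ alpha) (`|z| `^ alpha) + L <= `|x - z| ->
    T <= `|x - z| -> B <= `|f x - f z|.
Proof.
split=> [fe L B L0|fe L L0].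
  have [rho [_ rhoy rhof]] := fe L L0.
  have /cvgryPge/(_ B)[T [_ TB]] := rhoy.
  exists (T + 1) => x z Lxz Txz; apply: le_trans (rhof x z Lxz).
  by apply: TB; rewrite (lt_le_trans _ Txz)// ltrDl.
pose D t := [set `|f u.1 - f u.2| | u in [set u : X * X |
  L * Num.max (`|u.1| `^ alpha) (`|u.2| `^ alpha) + L <= `|u.1 - u.2| /\
  t <= `|u.1 - u.2|]].
pose rho t := inf (t |` D t).
have D0 t s : 0 <= t -> (t |` D t) s -> 0 <= s.
  by move=> t0 [->|[u _ <-]].
have Dinf t : 0 <= t -> has_inf (t |` D t).
  by move=> t0; split; [exists t; left|exists 0 => s; exact: D0].
exists rho; split=> [t t0||x z Lxz].
- by apply: lb_le_inf; [exists t; left|move=> s; exact: D0].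
- apply/cvgryPge => B; have [T TB] := fe L B L0.
  near=> t; apply: lb_le_inf; first by exists t; left.
  move=> s [->|[[x z] /= [Lxz txz] <-]].
    by near: t; apply: nbhs_pinfty_ge; exact: num_real.
  apply: TB => //; apply: le_trans txz; near: t; apply: nbhs_pinfty_ge.
  exact: num_real.
- apply: ge_inf; first by have [] := Dinf _ (normr_ge0 (x - z)).
  by right; exists (x, z).
Unshelve. all: by end_near.
Qed.

End coarse_bound.

(** * The obstruction *)

Section obstruction.
Context (R : realType) (p q : R) (p1 : 1 <= p) (q1 : 1 <= q).

(** The test functions [h i] represent the [s]-th power of the distance, up to constants, as a sum
    of [r]-th powers of scalar differences; this transfers the scalar grid inequality to [f]. It is
    used with [r = s = q], and with [r = 2], [s = q]. *)
Lemma not_expanding (r s c C alpha : R) (I : choiceType) (h : I -> lp q1 -> R)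
    (f : lp p1 -> lp q1) :
  2 <= r -> r < p -> 0 < s -> 0 < c -> 0 < C ->
  (forall u v, exists S, [/\ hsum (fun i => `|h i u - h i v| `^ r) S,
     c * `|u - v| `^ s <= S & S <= C * `|u - v| `^ s]) ->
  0 <= alpha -> alpha <= (p - r) / p ->
  coarse f -> ~ expanding_at_rate alpha f.
Proof.
move=> r2 rp s0 c0 C0 hS al0 alp /coarseP fc /expanding_at_rateP fe.
have [Sf hSf] : {S : lp q1 -> lp q1 -> R & forall u v,
    [/\ hsum (fun i => `|h i u - h i v| `^ r) (S u v),
     c * `|u - v| `^ s <= S u v & S u v <= C * `|u - v| `^ s]}.
  exists (fun u v => projT1 (cid (hS u v))) => u v.
  exact: projT2 (cid (hS u v)).
have p0 : 0 < p by exact: lt_le_trans p1.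
have r0 : 0 < r by exact: lt_le_trans r2.
have [A fA] := fc 1 ler01.
have A0 : 0 <= A by apply: le_trans (fA 0 0 _); rewrite ?subrr ?normr0.
pose A' := C * A `^ s.
(* The final [+ 1] makes the contradiction strict; [B] below is chosen so that [c * B ^ s = D]. *)
pose D := 3 `^ (r - 1) * (2 + 2 `^ r) * A' + 1.
have A'0 : 0 <= A' by rewrite mulr_ge0 ?powR_ge0// ltW.
have D0 : 0 <= D.
  by rewrite addr_ge0// mulr_ge0// mulr_ge0 ?addr_ge0 ?powR_ge0.
pose B := (D / c) `^ s^-1.
(* The constant [4^-1] suffices: the endpoints will be at distance at least [M ^ b >= 1], while the
   maximum of their norms to the power [alpha] is at most [2 * M ^ b]. *)
have [T TB] := fe (4^-1) B ltac:(by rewrite invr_gt0).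
pose b := (p - r) / p.
have b0 : 0 < b by rewrite divr_gt0// subr_gt0.
have [M M0 MT] : exists2 M : nat, (0 < M)%N & Num.max 1 T `^ b^-1 <= M%:R.
  by exists (Num.trunc (Num.max 1 T `^ b^-1)).+1 => //; rewrite ltW// truncnS_gt.
have m1 : 1 <= Num.max 1 T by rewrite le_max lexx.
have M1 : 1 <= M%:R :> R by rewrite ler1n.
have Mb : Num.max 1 T <= M%:R `^ b.
  have <- : (Num.max 1 T `^ b^-1) `^ b = Num.max 1 T.
    by rewrite -powRrM mulVf ?gt_eqF// powRr1// (le_trans ler01).
  by apply: le_powR_base MT; rewrite ?powR_ge0// ltW.
have Mb1 : 1 <= M%:R `^ b by exact: le_trans Mb.
have Mr1 : 1 <= M%:R `^ r :> R.
  by rewrite powR_ge1// ltW.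
have [N [N0 NMr MrN]] : exists N : nat,
    [/\ 0 < N%:R :> R, M%:R `^ r <= N%:R :> R & N%:R <= 2 * M%:R `^ r :> R].
  exists (Num.trunc (M%:R `^ r : R)).+1; split; rewrite ?ltr0n//.
    by rewrite ltW// truncnS_gt.
  by rewrite -natr1 mulr_natl mulr2n lerD// truncn_le powR_ge0.
(* The mesh, normalised by [sigma ^ p * N = 1]: moving all [N] coordinates by at most 1 gives norm
   at most 1. *)
pose sigma : R := N%:R `^ (- p^-1).
have sg0 : 0 < sigma by exact: powR_gt0.
have sgp : sigma `^ p * N%:R = 1.
  by rewrite -powRrM mulNr mulVf ?gt_eqF// powR_inv1 ?ltW// mulVf ?gt_eqF.
have [V [Vn Vd]] := vec_in_lp p1 N.
pose W z := sigma *: V z.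
have Wd z w : `|W z - W w| `^ p = sigma `^ p * \sum_i `|z i - w i| `^ p.
  by rewrite -scalerBr normrZ powRM// Vd gtr0_norm.
have Wn z : `|W z| `^ p = sigma `^ p * \sum_i `|z i| `^ p.
  by rewrite normrZ powRM// Vn gtr0_norm.
have bigc (a : R) : \sum_(i < N) a = N%:R * a.
  by rewrite sumr_const card_ord mulr_natl.
have Wd1 z w : (forall i, `|z i - w i| <= 1) -> `|W z - W w| <= 1.
  move=> zw; apply: (powR_le_cancel p0) => //; rewrite Wd powR1 -[leRHS]sgp.
  rewrite ler_wpM2l ?powR_ge0// -[leRHS]mulr1 -bigc ler_sum// => i _.
  by rewrite powR_le1// ltW.
have Wn2 z : (forall i, `|z i| <= (2 * M)%:R) -> `|W z| <= (2 * M)%:R.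
  move=> zM; apply: (powR_le_cancel p0) => //; rewrite Wn.
  have -> : (2 * M)%:R `^ p = sigma `^ p * (N%:R * (2 * M)%:R `^ p) :> R.
    by rewrite mulrA sgp mul1r.
  rewrite ler_wpM2l ?powR_ge0// -bigc ler_sum// => i _.
  by rewrite le_powR_base// ltW.
have ptM (x : {ffun 'I_N -> 'I_M}) j a : a = 0 \/ a = (2 * M)%:R ->
    forall i, `|upd (pt R x) j a i| <= (2 * M)%:R.
  move=> aM i; rewrite /upd; case: eqP => _.
    by case: aM => ->; rewrite ?normr0 ?ger0_norm.
  rewrite /pt ger0_norm// ler_nat.
  apply: (@leq_trans (2 * (x i).+1)%N); first by rewrite mulnS addnC leq_add2r.
  by rewrite leq_mul2l ltn_ord.
have Wfar (x : {ffun 'I_N -> 'I_M}) j :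
    `|W (upd (pt R x) j (2 * M)%:R) - W (upd (pt R x) j 0)| = sigma * (2 * M)%:R.
  have sM0 : 0 <= sigma * (2 * M)%:R by rewrite mulr_ge0// ltW.
  apply: (powR_injective p0); rewrite ?nnegrE//.
  rewrite Wd powRM ?(ltW sg0)//; congr (_ * _).
  rewrite (bigD1 j)//= big1 ?addr0; first by rewrite /upd eqxx subr0 ger0_norm.
  by move=> i /negPf ij; rewrite /upd ij subrr normr0 powR0// gt_eqF.
(* From [N <= 2 * M ^ r], the distance is at least [2 ^ (1 - 1/p) * M ^ (1 - r/p)], and
   [b = 1 - r/p]. *)
have sigM : M%:R `^ b <= sigma * (2 * M)%:R.
  have : (2 * M%:R `^ r) `^ (- p^-1) <= sigma.
    have Q0 : 0 < 2 * M%:R `^ r :> R by exact: lt_le_trans MrN.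
    rewrite /sigma !powRN lef_pV2 ?posrE; [|exact: powR_gt0|exact: powR_gt0].
    by apply: le_powR_base MrN; rewrite ?invr_ge0 ltW.
  move=> h1; apply: le_trans (ler_wpM2r (ler0n R (2 * M)) h1).
  rewrite powRM ?powR_ge0// -powRrM natrM -[X in _ * (_ * X)](powRr1 (ler0n R M)).
  rewrite mulrACA -powRD; last by rewrite (gt_eqF (lt_le_trans ltr01 M1)) implybT.
  have -> : r * - p^-1 + 1 = b by rewrite /b; field; rewrite gt_eqF.
  rewrite ler_peMl ?powR_ge0// -{2}(powRr1 (ler0n R 2)) -powRD ?pnatr_eq0 ?implybT//.
  by apply: powR_ge1; [rewrite addrC subr_ge0 invf_le1|rewrite ler1n].
have Bfar (x : {ffun 'I_N -> 'I_M}) j :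
    B <= `|f (W (upd (pt R x) j (2 * M)%:R)) - f (W (upd (pt R x) j 0))|.
  have Mal z : `|W z| <= (2 * M)%:R -> `|W z| `^ alpha <= 2 * M%:R `^ b.
    move=> zM; apply: le_trans (_ : (2 * M)%:R `^ alpha <= _).
      by rewrite le_powR_base.
    rewrite natrM powRM// ler_pM ?powR_ge0//; last exact: ler_powR.
    rewrite -[leRHS]powRr1// ler_powR ?ler1n//.
    by apply: le_trans alp _; rewrite ler_pdivrMr// mul1r gerBl ltW.
  apply: TB; rewrite Wfar; last first.
    by apply: le_trans sigM; apply: le_trans Mb; rewrite le_max lexx orbT.
  apply: le_trans sigM.
  have : Num.max (`|W (upd (pt R x) j (2 * M)%:R)| `^ alpha)
      (`|W (upd (pt R x) j 0)| `^ alpha) <= 2 * M%:R `^ b.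
    by rewrite ge_max; apply/andP; split; apply: Mal; apply: Wn2; apply: ptM; [right|left].
  move: Mb1; set u := M%:R `^ b; set v := Num.max _ _ => u1 vu; lra.
have := @family_cotype _ N M I (fun i z => h i (f (W z)))
  (fun z w => Sf (f (W z)) (f (W w))) r A' D M0 r2.
move=> H; have {H} : N%:R * D <= 3 `^ (r - 1) * (2 * N%:R + (2 * M)%:R `^ r) * A'.
  apply: H.
- by move=> z w; have [] := hSf (f (W z)) (f (W w)).
- move=> z w zw; have [_ _ /le_trans] := hSf (f (W z)) (f (W w)); apply.
  rewrite ler_wpM2l ?(ltW C0)// le_powR_base ?(ltW s0)//.
  by apply: fA; exact: Wd1.
- move=> x j.
  have [_ h1 _] := hSf (f (W (upd (pt R x) j (2 * M)%:R)))
    (f (W (upd (pt R x) j 0))).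
  apply: le_trans h1; rewrite mulrC -ler_pdivrMr//.
  have -> : D / c = B `^ s.
    by rewrite -powRrM mulVf ?gt_eqF// powRr1// divr_ge0// ltW.
  by rewrite le_powR_base ?powR_ge0 ?(ltW s0).
(* Since [M ^ r <= N], the right-hand side is at most [N * (D - 1)]. *)
apply/negP; rewrite -ltNge.
apply: le_lt_trans (_ : N%:R * (3 `^ (r - 1) * (2 + 2 `^ r) * A') < _); last first.
  by rewrite ltr_pM2l// /D ltrDl.
have -> : N%:R * (3 `^ (r - 1) * (2 + 2 `^ r) * A') =
    3 `^ (r - 1) * (2 * N%:R + 2 `^ r * N%:R) * A' by ring.
rewrite ler_wpM2r// ler_wpM2l ?powR_ge0// lerD2l natrM powRM//.
by rewrite ler_wpM2l ?powR_ge0.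
Qed.

End obstruction.

(** * Trigonometric test functions *)

Section series_sums.
Context (R : realType).

Lemma hsum_cvg (u : nat -> R) (l : R) : (forall n, 0 <= u n) ->
  series u @ \oo --> l -> hsum u l.
Proof.
move=> u0 ul; split=> //.
rewrite -nneseries_esumT; last by move=> n; rewrite lee_fin.
have -> : (fun n => \sum_(0 <= i < n) (u i)%:E)%E = EFin \o series u.
  by apply/funext => n; rewrite /= sumEFin.
rewrite EFin_lim; last by apply/cvg_ex; exists l.
by congr (_%:E); exact/cvg_lim.
Qed.

Lemma hsum_geometric (z : R) : 0 <= z -> z < 1 ->
  hsum (fun n => z ^+ n) (1 - z)^-1.
Proof.
move=> z0 z1; rewrite -[X in hsum _ X]mul1r.
apply: eq_hsum (hsum_cvg _ (cvg_geometric_series _)).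
- by move=> n; rewrite /geometric/= mul1r.
- by move=> n; rewrite /geometric/= mul1r exprn_ge0.
- by rewrite ger0_norm.
Qed.

Lemma hsum_int (h : int -> R) s t : hsum (h \o Posz) s -> hsum (h \o Negz) t ->
  hsum h (s + t).
Proof.
move=> hs ht.
pose g n := if n is Posz _ then h n else 0.
pose k n := if n is Negz _ then h n else 0.
have gs : hsum g s.
  by apply: (@hsum_inj _ _ _ Posz) => // [i j []//|[i /(_ i)//|//]].
have kt : hsum k t.
  by apply: (@hsum_inj _ _ _ Negz) => // [i j []//|[//|i /(_ i)//]].
by apply: eq_hsum (hsumD gs kt) => -[n|n]; rewrite /= ?addr0 ?add0r.
Qed.

End series_sums.

Section chord.
Context (R : realType).

Lemma norm_sin_le (t : R) : `|sin t| <= `|t|.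
Proof.
wlog t0 : t / 0 <= t.
  move=> H; have [/H//|/ltW t0] := leP 0 t.
  by have := H (- t); rewrite oppr_ge0 sinN !normrN; apply.
have [|c _ /=] := @MVT_segment _ sin cos 0 t t0.
- apply: continuous_subspaceT; exact: continuous_sin.
- by rewrite sin0 !subr0 => ->; rewrite normrM ler_piMl// cos_max.
Qed.

Lemma cos_ge (t : R) : 1 - cos t <= t ^+ 2.
Proof.
wlog t0 : t / 0 <= t.
  move=> H; have [/H//|/ltW t0] := leP 0 t.
  by have := H (- t); rewrite oppr_ge0 cosN sqrrN; apply.
have [|c ct /=] := @MVT_segment _ cos (fun t => - sin t) 0 t t0.
- apply: continuous_subspaceT; exact: continuous_cos.
- rewrite cos0 subr0 => E; rewrite -opprB E mulNr opprK expr2 ler_wpM2r//.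
  move: ct; rewrite in_itv/= => /andP[c0 ct].
  apply: le_trans (ler_norm _) (le_trans (norm_sin_le _) _).
  by rewrite ger0_norm.
Qed.

Lemma cos1_lt1 : cos 1 < 1 :> R.
Proof.
rewrite -[ltRHS]cos0 ltr_cos ?ltr01//; rewrite in_itv/= ?lexx ?pi_ge0//.
by rewrite ler01 (le_trans _ (pi_ge2 R))// ler1n.
Qed.

Lemma cos_le_cos1 (t : R) : 1 <= `|t| <= 2 -> cos t <= cos 1.
Proof.
move=> /andP[t1 t2]; rewrite -cos_norm leNgt ltr_cos; first by rewrite -leNgt.
- by rewrite in_itv/= normr_ge0 (le_trans t2 (pi_ge2 R)).
- by rewrite in_itv/= ler01 (le_trans _ (pi_ge2 R))// ler1n.
Qed.

Definition dyad (n : int) : R := 2 `^ n%:~R.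

Lemma dyad_gt0 n : 0 < dyad n. Proof. exact: powR_gt0. Qed.

Lemma dyadD m n : dyad (m + n) = dyad m * dyad n.
Proof. by rewrite /dyad intrD powRD// pnatr_eq0 implybT. Qed.

(** [m] is minus the integer part of the binary logarithm of [d]. *)
Lemma dyad_scale (d : R) : 0 < d -> exists m, 1 <= dyad m * d < 2.
Proof.
move=> d0; have l2 : 0 < ln 2 :> R by rewrite ln_gt0// ltr1n.
pose x := ln d / ln 2; have dx : d = 2 `^ x.
  by rewrite /powR pnatr_eq0/= /x divfK ?gt_eqF// lnK.
exists (- Num.floor x).
have -> : dyad (- Num.floor x) * d = 2 `^ (x - (Num.floor x)%:~R).
  rewrite /dyad dx -powRD; last by rewrite pnatr_eq0 implybT.
  by rewrite intrN addrC.
have /andP[fx xf] := floor_itv x; apply/andP; split.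
  by apply: powR_ge1; [rewrite subr_ge0|rewrite ler1n].
have xf1 : x - (Num.floor x)%:~R < 1 by rewrite ltrBlDl -(intrD _ _ 1).
rewrite -[ltRHS](powRr1 (ler0n R 2)) /powR pnatr_eq0/= ltr_expR.
by rewrite ltr_pM2r.
Qed.

Variable q : R.
Hypotheses (q0 : 0 < q) (q2 : q < 2).

(* [2^(-nq) |exp(i 2^n s) - exp(i 2^n t)|^2] for [d = s - t]; summed over [n] in
   [Z] it is comparable to [|s - t|^q] by dyadic self-similarity. *)
Definition chord (d : R) (n : int) : R :=
  dyad n `^ (- q) * (2 * (1 - cos (dyad n * d))).

Lemma chord_ge0 d n : 0 <= chord d n.
Proof. by rewrite mulr_ge0 ?powR_ge0// mulr_ge0// subr_ge0 cos_le1. Qed.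

Lemma dyad_nat (n : nat) (s : R) : dyad n `^ s = (2 `^ s) ^+ n.
Proof. by rewrite /dyad -powRrM -powR_mulrn ?powR_ge0// -powRrM mulrC. Qed.

Lemma dyadN n : dyad (- n) = (dyad n)^-1.
Proof. by rewrite /dyad intrN powRN. Qed.

Lemma powR2_lt1 (s : R) : s < 0 -> 2 `^ s < 1 :> R.
Proof.
move=> s0; rewrite -[s]opprK powRN invf_lt1 ?powR_gt0//.
rewrite -[ltLHS](powRr0 2) /powR pnatr_eq0/= ltr_expR.
by rewrite ltr_pM2r ?oppr_gt0// ln_gt0 ?ltr1n.
Qed.

(** For [n >= 0] the bound [1 - cos <= 2] gives a geometric series of ratio [2 ^ (- q)]; for [n < 0]
    the bound [1 - cos t <= t ^ 2] gives ratio [2 ^ (q - 2)]. Both ratios are below 1 as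
    [0 < q < 2]. *)
Lemma chord_major : exists w W, hsum w W /\
  forall d n, `|d| < 2 -> chord d n <= w n.
Proof.
pose a : R := 2 `^ (- q); pose b : R := 2 `^ (q - 2).
have a1 : a < 1 by apply: powR2_lt1; rewrite oppr_lt0.
have b1 : b < 1 by apply: powR2_lt1; rewrite subr_lt0.
pose w (n : int) : R := match n with Posz n => 4 * a ^+ n | Negz n => 8 * b ^+ n end.
have hP : hsum (w \o Posz) (4 * (1 - a)^-1).
  by apply: hsumZ => //; apply: hsum_geometric; rewrite ?powR_ge0.
have hN : hsum (w \o Negz) (8 * (1 - b)^-1).
  by apply: hsumZ => //; apply: hsum_geometric; rewrite ?powR_ge0.
exists w, (4 * (1 - a)^-1 + 8 * (1 - b)^-1); split; first exact: hsum_int.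
move=> d [n|n] d2; rewrite /w /chord.
  rewrite dyad_nat mulrC ler_wpM2r ?exprn_ge0 ?powR_ge0//.
  have := cos_geN1 (dyad n * d); lra.
rewrite NegzE; set l := dyad _; have l0 : 0 < l by exact: dyad_gt0.
apply: le_trans (_ : l `^ (- q) * (2 * (l ^+ 2 * 4)) <= _).
  rewrite ler_wpM2l ?powR_ge0// ler_wpM2l//.
  apply: le_trans (cos_ge _) _; rewrite exprMn ler_wpM2l ?sqr_ge0//.
  rewrite -real_normK ?num_real// (_ : 4 = 2 ^+ 2) ?lerXn2r ?nnegrE// ?ltW//.
  by rewrite -natrX.
have -> : l `^ (- q) * (2 * (l ^+ 2 * 4)) = 8 * l `^ (2 - q).
  rewrite powRD; last by rewrite (gt_eqF l0) implybT.
  by rewrite -(powR_mulrn 2 (ltW l0)); ring.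
rewrite ler_wpM2l// /l dyadN.
have -> : (dyad n.+1)^-1 `^ (2 - q) = b ^+ n.+1.
  rewrite -(powR_inv1 (ltW (dyad_gt0 _))) -powRrM dyad_nat; congr (_ ^+ _).
  by rewrite /b; congr (_ `^ _); ring.
by rewrite exprS ler_piMl ?exprn_ge0 ?powR_ge0// ltW.
Qed.

(** With [1 <= 2^m |d| < 2], shifting [n] by [m] replaces [d] by [2^m d] at the cost of the factor
    [2^(-mq)], which is comparable to [|d|^q]. The upper bound is then [chord_major], and the lower
    one the single term [n = 0]. *)
Lemma chord_sum : exists c C, [/\ 0 < c, 0 < C & forall d, exists S,
  [/\ hsum (chord d) S, c * `|d| `^ q <= S & S <= C * `|d| `^ q]].
Proof.
have [w [W [wW wP]]] := chord_major.
have W0 : 0 <= W := hsum_ge0 wW.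
exists (2 * (1 - cos 1) / 2 `^ q), (W + 1); split.
- by rewrite divr_gt0 ?powR_gt0// mulr_gt0// subr_gt0 cos1_lt1.
- by rewrite ltr_wpDl.
move=> d; have [->|dn0] := eqVneq d 0.
  exists 0; rewrite normr0 powR0 ?gt_eqF// !mulr0; split=> //.
  by apply: eq_hsum (hsum0 _ _) => n; rewrite /chord mulr0 cos0 subrr !mulr0.
have d0 : 0 < `|d| by rewrite normr_gt0.
have [m /andP[m1 m2]] := dyad_scale d0.
have l0 := dyad_gt0 m; have lq : 0 < dyad m `^ q by exact: powR_gt0.
have ld : `|dyad m * d| = dyad m * `|d| by rewrite normrM gtr0_norm.
have sh n : chord d (n + m) = dyad m `^ (- q) * chord (dyad m * d) n.
  rewrite /chord dyadD (powRM _ (ltW (dyad_gt0 n)) (ltW l0)) -(mulrA (dyad n)).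
  by rewrite (mulrC (dyad n `^ _)) -(mulrA (dyad m `^ _)).
have [s hs sW] : exists2 s, hsum (fun n => chord d (n + m)) s &
    s <= dyad m `^ (- q) * W.
  apply: hsum_dom (hsumZ (powR_ge0 _ _) wW) => n; first exact: chord_ge0.
  by rewrite sh ler_wpM2l ?powR_ge0// wP// ld.
exists s; split.
- apply: (@hsum_inj _ _ _ (fun n => n + m)) hs; first exact: addIr.
  by move=> j /(_ (j - m)); rewrite subrK.
- apply: le_trans (hsum_term 0 hs); rewrite /= sh.
  have -> : chord (dyad m * d) 0 = 2 * (1 - cos (dyad m * d)).
    by rewrite /chord /dyad mulr0z powRr0 powR1 !mul1r.
  rewrite mulrC mulrA ler_pdivrMr ?powR_gt0// mulrAC.
  apply: ler_pM; rewrite ?powR_ge0// ?mulr_ge0 ?subr_ge0 ?cos_le1//.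
    rewrite -(ler_pM2l lq) mulrA powRN mulfV ?gt_eqF// mul1r -powRM ?(ltW l0)//.
    by apply: le_powR_base; rewrite ?(ltW q0) ?mulr_ge0 ?(ltW l0)// ltW.
  rewrite ler_wpM2l// lerD2l lerN2; apply: cos_le_cos1.
  by rewrite ld m1 ltW.
- apply: le_trans sW _; rewrite mulrC; apply: ler_pM; rewrite ?powR_ge0// ?lerDl//.
  rewrite -(ler_pM2l lq) powRN mulfV ?gt_eqF// -powRM ?(ltW l0)//.
  exact: powR_ge1 (ltW q0) m1.
Qed.

End chord.

Section test_families.
Context (R : realType) (q : R) (q1 : 1 <= q).

Lemma coord_family (u v : lp q1) : exists S,
  [/\ hsum (fun k => `|coord u k - coord v k| `^ q) S,
     1 * `|u - v| `^ q <= S & S <= 1 * `|u - v| `^ q].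
Proof.
by exists (`|u - v| `^ q); rewrite mul1r; split=> //; exact: (lp_hsum (u - v)).
Qed.

(** The index consists of a coordinate, a dyadic scale and the choice of cosine or sine; the weight
    is the square root of the one in [chord]. *)
Definition trig_family (i : nat * int * bool) (u : lp q1) : R :=
  dyad R i.1.2 `^ (- (q / 2)) *
  (if i.2 then cos else sin) (dyad R i.1.2 * coord u i.1.1).

(** The squared cosine and sine differences add up to a [chord]; summing over scales gives the
    [q]-th power of each coordinate difference, up to constants, and summing over coordinates gives
    the norm. *)
Lemma trig_familyP : q < 2 -> exists c C, [/\ 0 < c, 0 < C &
  forall u v : lp q1, exists S,
    [/\ hsum (fun i => `|trig_family i u - trig_family i v| `^ 2) S,
     c * `|u - v| `^ q <= S & S <= C * `|u - v| `^ q]].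
Proof.
move=> q2; have q0 : 0 < q by exact: lt_le_trans q1.
have [c [C [c0 C0 cC]]] := chord_sum q0 q2; exists c, C; split=> // u v.
pose d k := coord u k - coord v k.
have bs kn : hsum (fun b => `|trig_family (kn, b) u - trig_family (kn, b) v| `^ 2)
    (chord q (d kn.1) kn.2).
  have := @hsum_fin R bool
    (fun b => `|trig_family (kn, b) u - trig_family (kn, b) v| `^ 2)
    (fun b => powR_ge0 _ _).
  congr (hsum _ _); rewrite big_bool /trig_family/= /chord /d.
  rewrite !powR_mulrn// !real_normK ?num_real// -!mulrBr !exprMn -mulrDr.
  have -> : (dyad R kn.2 `^ (- (q / 2))) ^+ 2 = dyad R kn.2 `^ (- q).
    rewrite -(powR_mulrn 2 (powR_ge0 _ _)) -powRrM; congr (_ `^ _).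
    by rewrite mulNr divfK.
  rewrite (mulrBr (dyad R kn.2)) cosB.
  set x := dyad R kn.2 * coord u kn.1; set y := dyad R kn.2 * coord v kn.1.
  suff -> : (cos x - cos y) ^+ 2 + (sin x - sin y) ^+ 2 =
    2 * (1 - (cos x * cos y + sin x * sin y)) by [].
  have := cos2Dsin2 x; have := cos2Dsin2 y; rewrite !sqrrB; lra.
pose S k := projT1 (cid (cC (d k))).
have SP k : [/\ hsum (chord q (d k)) (S k), c * `|d k| `^ q <= S k &
    S k <= C * `|d k| `^ q] by exact: projT2 (cid (cC (d k))).
have dq : hsum (fun k => `|d k| `^ q) (`|u - v| `^ q) := lp_hsum (u - v).
have [T hT TC] : exists2 T, hsum S T & T <= C * `|u - v| `^ q.
  apply: hsum_dom (hsumZ (ltW C0) dq) => k; have [h1 _ h2] := SP k => //.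
  exact: hsum_ge0 h1.
exists T; split=> //.
  have kn : hsum (fun kn : nat * int => chord q (d kn.1) kn.2) T.
    by apply: (hsum_prod (h := fun k n => chord q (d k) n)) hT => k; have [] := SP k.
  by apply: eq_hsum (hsum_prod bs kn) => -[].
by apply: hsum_le (hsumZ (ltW c0) dq) hT => k; have [] := SP k.
Qed.

End test_families.

(** * The Mazur map *)

Section families_in_lp.
Context (R : realType) (p : R) (p1 : 1 <= p) (I : countType) (X : Type).

Lemma fam_lp (g : X -> I -> R) :
  (forall x, exists s, hsum (fun i => `|g x i| `^ p) s) ->
  exists F : X -> lp p1, [/\ forall x, coord (F x) = fam (g x),
    forall x s, hsum (fun i => `|g x i| `^ p) s -> `|F x| `^ p = s &
    forall x y s, hsum (fun i => `|g x i - g y i| `^ p) s -> `|F x - F y| `^ p = s].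
Proof.
move=> gs; have p0 : p != 0 by rewrite gt_eqF// (lt_le_trans ltr01 p1).
have fs x s : hsum (fun i => `|g x i| `^ p) s -> hsum (fun k => `|fam (g x) k| `^ p) s.
  move=> /hsum_fam; apply: eq_hsum => k.
  by rewrite (fam2 (F := fun a _ => `|a| `^ p) (g x) (g x))// normr0 powR0.
have Fx x : {F : lp p1 | coord F = fam (g x)}.
  apply: cid; have [s /fs hs] := gs x; have [F Fg _] := lp_mem p1 hs.
  by exists F.
exists (fun x => projT1 (Fx x)); split=> [x|x s hs|x y s hs].
- exact: projT2 (Fx x).
- have := lp_hsum (projT1 (Fx x)); rewrite (projT2 (Fx x)) => h.
  exact: hsum_unique h (fs _ _ hs).
- apply: hsum_unique (lp_hsum _) _.
  apply: eq_hsum (hsum_fam hs) => k; rewrite coordB !(projT2 (Fx _)).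
  by rewrite (fam2 (F := fun a b => `|a - b| `^ p))// subrr normr0 powR0.
Qed.

End families_in_lp.

Section positive_parts.
Context (R : realType) (p : R) (p1 : 1 <= p).

Definition pospart (u : lp p1) (i : nat * bool) : R :=
  Num.max 0 (if i.2 then coord u i.1 else - coord u i.1).

(** If [a] and [b] are the differences of the positive and of the negative parts, then [a + b] is
    the coordinate difference, and [a^p + b^p <= (a + b)^p <= 2^p (a^p + b^p)]. *)
Lemma positive_parts : exists P : lp p1 -> lp p1,
  [/\ forall u k, 0 <= coord (P u) k, forall u, `|P u| = `|u|,
      forall u v, `|P u - P v| <= `|u - v| &
      forall u v, `|u - v| <= 2 * `|P u - P v|].
Proof.
have p0 : 0 < p by exact: lt_le_trans p1.
have hb (w : nat -> bool -> R) : (forall k b, 0 <= w k b) -> forall s,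
    hsum (fun k => w k true + w k false) s -> hsum (fun i => w i.1 i.2) s.
  move=> w0 s; apply: (hsum_prod (h := w)) => k.
  by have := hsum_fin (w0 k); rewrite big_bool.
have hn u : hsum (fun i => `|pospart u i| `^ p) (`|u| `^ p).
  apply: (hb (fun k b => `|pospart u (k, b)| `^ p)) => [k b|]; first exact: powR_ge0.
  apply: eq_hsum (lp_hsum u) => k; rewrite /pospart/=.
  have [h|h] := leP 0 (coord u k).
    by rewrite max_l ?oppr_le0// normr0 powR0 ?addr0// gt_eqF.
  by rewrite max_r ?oppr_ge0 ?(ltW h)// normr0 powR0 ?add0r ?normrN// gt_eqF.
pose a (u v : lp p1) k b : R := `|pospart u (k, b) - pospart v (k, b)|.
have aE u v k : a u v k true + a u v k false = `|coord u k - coord v k|.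
  exact: dist_posnegE.
have a0 u v k b : 0 <= a u v k b by exact: normr_ge0.
have hd u v : exists S, [/\ hsum (fun i => `|pospart u i - pospart v i| `^ p) S,
    S <= `|u - v| `^ p & `|u - v| `^ p <= 2 `^ p * S].
  have dk := lp_hsum (u - v).
  have [S hS SD] : exists2 S, hsum (fun k => a u v k true `^ p + a u v k false `^ p) S &
      S <= `|u - v| `^ p.
    apply: hsum_dom dk => k; first by rewrite addr_ge0 ?powR_ge0.
    by rewrite coordB -aE powR_superadd.
  exists S; split=> //.
    by apply: (hb (fun k b => a u v k b `^ p)) hS => k b; exact: powR_ge0.
  apply: hsum_le dk (hsumZ (powR_ge0 2 p) hS) => k.
  by rewrite coordB -aE powR_add_le.
have [u|P [Pc Pn Pd]] := @fam_lp _ _ p1 (nat * bool)%type _ pospart.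
  by exists (`|u| `^ p); exact: hn.
exists P; split=> [u k|u|u v|u v].
- by rewrite Pc /fam; case: pickle_inv => // i; rewrite le_max lexx.
- by apply: (powR_injective p0); rewrite ?nnegrE// (Pn _ _ (hn u)).
- have [S [hS SD _]] := hd u v.
  by apply: (powR_le_cancel p0) => //; rewrite (Pd _ _ _ hS).
- have [S [hS _ SD]] := hd u v.
  by apply: (powR_le_cancel p0); rewrite ?mulr_ge0// powRM// (Pd _ _ _ hS).
Qed.

End positive_parts.

Section mazur.
Context (R : realType) (p q : R) (p1 : 1 <= p) (q1 : 1 <= q).
Hypothesis qp : q < p.

Let p0 : 0 < p. Proof. exact: lt_le_trans p1. Qed.
Let q0 : 0 < q. Proof. exact: lt_le_trans q1. Qed.
Let th : R := p / q.
Let th1 : 1 <= th. Proof. by rewrite ler_pdivlMr// mul1r ltW. Qed.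
Let th0 : 0 <= th. Proof. exact: le_trans th1. Qed.
Let thq : th * q = p. Proof. by rewrite divfK// gt_eqF. Qed.

(** Young's inequality with exponents [p / q] and [p / (p - q)] for the normalised quantities; the
    weights [q / p] and [(p - q) / p] are bounded by 1. Summed over coordinates, it serves as
    Hölder's inequality. *)
Lemma young_mix (d w D r : R) : 0 <= d -> 0 <= w -> 0 < D -> 0 < r ->
  d `^ q * w `^ (p - q) <=
  D `^ q * r `^ (p - q) * (d `^ p / D `^ p + w `^ p / r `^ p).
Proof.
move=> d0 w0 D0 r0; have pq0 : 0 < p - q by rewrite subr_gt0.
have := @conjugate_powR _ ((d / D) `^ q) ((w / r) `^ (p - q)) (p / q) (p / (p - q))
  (powR_ge0 _ _) (powR_ge0 _ _) (divr_gt0 p0 q0) (divr_gt0 p0 pq0).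
rewrite -!powRrM !(mulrCA _ p) !divff ?(gt_eqF q0) ?(gt_eqF pq0)// !mulr1.
rewrite !invf_div -mulrDl addrC subrK divff ?(gt_eqF p0)// => /(_ erefl).
have dv (x y s : R) : 0 <= x -> 0 < y -> (x / y) `^ s = x `^ s / y `^ s.
  move=> x0 y0; rewrite powRM ?invr_ge0 ?(ltW y0)//.
  by rewrite -(powR_inv1 (ltW y0)) -powRrM mulN1r powRN.
rewrite !dv// => h.
have Dq : 0 < D `^ q by exact: powR_gt0.
have rq : 0 < r `^ (p - q) by exact: powR_gt0.
have c1 : q / p <= 1 by rewrite ler_pdivrMr// mul1r ltW.
have c2 : (p - q) / p <= 1 by rewrite ler_pdivrMr// mul1r gerBl ltW.
have x0 : 0 <= d `^ p / D `^ p by rewrite divr_ge0 ?powR_ge0.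
have y0 : 0 <= w `^ p / r `^ p by rewrite divr_ge0 ?powR_ge0.
have -> : d `^ q * w `^ (p - q) = D `^ q * r `^ (p - q) *
    (d `^ q / D `^ q * (w `^ (p - q) / r `^ (p - q))).
  by field; rewrite !gt_eqF.
rewrite ler_wpM2l ?mulr_ge0 ?(ltW Dq) ?(ltW rq)//.
apply: le_trans h _; apply: lerD; exact: ler_piMr.
Qed.

Lemma mazur : exists (m : lp p1 -> lp q1) (C : R),
  [/\ 1 <= C, forall u, `|m u| = `|u| `^ th,
      (forall u k, coord (m u) k = `|coord u k| `^ th),
      (forall u v, (forall k, 0 <= coord u k) -> (forall k, 0 <= coord v k) ->
        `|u - v| `^ th <= `|m u - m v|) &
      (forall u v r, (forall k, 0 <= coord u k) -> (forall k, 0 <= coord v k) ->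
        `|u| <= r -> `|v| <= r ->
        `|m u - m v| <= C * (`|u - v| * r `^ (th - 1)))].
Proof.
have ms (u : lp p1) : hsum (fun k => `| (`|coord u k| `^ th) | `^ q) (`|u| `^ p).
  apply: eq_hsum (lp_hsum u) => k.
  by rewrite (ger0_norm (powR_ge0 _ _)) -powRrM thq.
have mx (u : lp p1) : {v : lp q1 | coord v = (fun k => `|coord u k| `^ th) &
    `|v| `^ q = `|u| `^ p} by apply: cid2; exact: lp_mem.
pose m u := s2val (mx u); have mc u : coord (m u) = (fun k => `|coord u k| `^ th).
  exact: s2valP (mx u).
(* [th ^ q] comes from the mean value estimate; 3 is 1 from the difference plus 2 from [u] and [v],
   because the [p]-th power of a maximum is at most the sum of the [p]-th powers. *)
pose C := (th `^ q * 3) `^ q^-1.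
have Cq : C `^ q = th `^ q * 3.
  by rewrite -powRrM mulVf ?gt_eqF// powRr1// mulr_ge0 ?powR_ge0.
exists m, C; split=> [|u|u k|u v u0 v0|u v r u0 v0 ur vr].
- apply: powR_ge1; first by rewrite invr_ge0 ltW.
  have : 1 <= th `^ q by apply: powR_ge1 => //; exact: ltW.
  lra.
- apply: (powR_injective q0); rewrite ?nnegrE ?powR_ge0//.
  by rewrite (s2valP' (mx u)) -powRrM thq.
- by rewrite mc.
- apply: (powR_le_cancel q0); rewrite ?powR_ge0// -powRrM thq.
  apply: hsum_le (lp_hsum (u - v)) (lp_hsum (m u - m v)) => k.
  rewrite !coordB !mc -[X in _ `^ X]thq powRrM.
  apply: le_powR_base; rewrite ?powR_ge0 ?(ltW q0)//.
  by rewrite (ger0_norm (u0 k)) (ger0_norm (v0 k)) dist_powR_ge.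
have [uv0|uvn] := eqVneq u v.
  by rewrite uv0 !subrr !normr0 mul0r mulr0.
have D0 : 0 < `|u - v| by rewrite normr_gt0 subr_eq0.
have r0 : 0 < r.
  rewrite lt_neqAle (le_trans (normr_ge0 u) ur) andbT; apply/eqP => r0.
  move: ur vr D0; rewrite -r0 !normr_le0 => /eqP -> /eqP ->.
  by rewrite subrr normr0 ltxx.
set D := `|u - v|; have C0 : 0 <= C by exact: powR_ge0.
have Dge : 0 <= D by exact: ltW.
apply: (powR_le_cancel q0); rewrite ?mulr_ge0 ?powR_ge0//.
rewrite powRM ?mulr_ge0 ?powR_ge0// Cq (powRM _ Dge (powR_ge0 _ _)) -powRrM.
rewrite mulrBl mul1r thq.
pose K := th `^ q * (D `^ q * r `^ (p - q)).
have K0 : 0 <= K by rewrite !mulr_ge0 ?powR_ge0.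
have h := hsumD (hsumZ (_ : 0 <= K / D `^ p) (lp_hsum (u - v)))
  (hsumZ (_ : 0 <= K / r `^ p) (hsumD (lp_hsum u) (lp_hsum v))).
apply: le_trans (hsum_le _ (lp_hsum (m u - m v)) (h _ _)) _.
- move=> k; rewrite !coordB !mc (ger0_norm (u0 k)) (ger0_norm (v0 k)).
  apply: le_trans (le_powR_base (ltW q0) (normr_ge0 _) (dist_powR_le (u0 k) (v0 k) th1)) _.
  set d := coord u k - coord v k; set w := Num.max _ _.
  have w0 : 0 <= w by rewrite le_max u0.
  rewrite -mulrA (powRM _ th0 (mulr_ge0 (normr_ge0 _) (powR_ge0 _ _))).
  rewrite (powRM _ (normr_ge0 _) (powR_ge0 _ _)) -powRrM mulrBl mul1r thq.
  apply: le_trans (ler_wpM2l (powR_ge0 _ _) (young_mix (normr_ge0 d) w0 D0 r0)) _.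
  rewrite -/D mulrA -/K mulrDr.
  have -> : K * (`|d| `^ p / D `^ p) = K / D `^ p * `|d| `^ p by ring.
  have -> : K * (w `^ p / r `^ p) = K / r `^ p * w `^ p by ring.
  rewrite lerD2l ler_wpM2l ?divr_ge0 ?powR_ge0// /w.
  by case: (leP (coord u k) (coord v k)) => _; rewrite ?lerDl ?lerDr powR_ge0.
- by rewrite divr_ge0 ?powR_ge0.
- by rewrite divr_ge0 ?powR_ge0.
have Dp : 0 < D `^ p by exact: powR_gt0.
have rp : 0 < r `^ p by exact: powR_gt0.
apply: le_trans (_ : K / D `^ p * D `^ p + K / r `^ p * (r `^ p + r `^ p) <= _).
  rewrite lerD2l ler_wpM2l ?divr_ge0 ?powR_ge0//.
  by apply: lerD; apply: le_powR_base; rewrite // ltW.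
rewrite le_eqVlt; apply/orP; left; apply/eqP; rewrite /K; field.
by rewrite !gt_eqF.
Qed.

End mazur.

Section homogeneous_mazur.
Context (R : realType) (p q : R) (p1 : 1 <= p) (q1 : 1 <= q).
Hypothesis qp : q < p.

Let p0 : 0 < p. Proof. exact: lt_le_trans p1. Qed.
Let q0 : 0 < q. Proof. exact: lt_le_trans q1. Qed.

(** The rescaled map [G] preserves norms. Either the norms of [u] and [v] differ enough to separate
    the images, or [v] can be rescaled so that both points lie in one ball, where [mazur] applies.
    Composing with the positive parts turns [/ 2] into [/ 4]. *)
Lemma homogeneous_mazur : exists (F : lp p1 -> lp q1) (C : R),
  (forall u v, `|F u - F v| <= C * `|u - v|) /\
  (forall u v, `|u - v| / 4 <= `|F u - F v| \/
     Num.max `|u| `|v| `^ (1 - p / q) * (`|u - v| / 4) `^ (p / q) <= `|F u - F v|).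
Proof.
have [m [C [C1 mn mc mge mle]]] := @mazur R p q p1 q1 qp.
have [P [P0 Pn Ple Pge]] := positive_parts p1.
have th1 : 1 < p / q by rewrite ltr_pdivlMr// mul1r.
move: (p / q) th1 mn mc mge mle => th th1 mn mc mge mle.
have th0 : 0 < th by exact: lt_trans th1.
have mZ (c : R) (u : lp p1) : 0 <= c -> m (c *: u) = c `^ th *: m u.
  move=> c0; apply: lp_ext => k.
  rewrite mc -[RHS]/(c `^ th * coord (m u) k) mc.
  rewrite -[coord (c *: u) k]/(c * coord u k).
  by rewrite normrM powRM// ger0_norm.
pose G (u : lp p1) := `|u| `^ (1 - th) *: m u.
have Gn u : `|G u| = `|u|.
  rewrite normrZ mn ger0_norm ?powR_ge0//.
  have [->|un] := eqVneq u 0; first by rewrite normr0 (powR0 (lt0r_neq0 th0)) mulr0.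
  by rewrite -powRD ?subrK ?powRr1// normr_eq0 un implybT.
have key (u v : lp p1) : (forall k, 0 <= coord u k) -> (forall k, 0 <= coord v k) ->
    `|v| <= `|u| -> 0 < `|v| ->
    `|G u - G v| <= 2 * C * `|u - v| /\
    (`|u - v| / 2 <= `|G u - G v| \/
     `|u| `^ (1 - th) * (`|u - v| / 2) `^ th <= `|G u - G v|).
  move=> u0 v0 vu vp; set a := `|u| in vu *; set b := `|v| in vu vp *.
  have ap : 0 < a by exact: lt_le_trans vu.
  (* This exponent makes [a ^ (1 - th) * c ^ th = b ^ (1 - th)]; [ka <= 1] keeps [c *: v] in the
     ball of radius [a]. *)
  pose ka := (th - 1) / th.
  have ka0 : 0 <= ka by rewrite divr_ge0 ?subr_ge0 ?(ltW th1)// ltW.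
  have ka1 : ka <= 1 by rewrite ler_pdivrMr// mul1r gerBl.
  pose c := (a / b) `^ ka.
  have ab1 : 1 <= a / b by rewrite ler_pdivlMr// mul1r.
  have c1 : 1 <= c by exact: powR_ge1.
  have cp : 0 < c by exact: lt_le_trans c1.
  have cab : c <= a / b by rewrite -[leRHS](powRr1 (le_trans ler01 ab1)) ler_powR.
  have cb : c * b <= a by rewrite -ler_pdivlMr.
  (* homogeneity: both images are the same multiple of values of [m] on a ball *)
  have GE : G u - G v = a `^ (1 - th) *: (m u - m (c *: v)).
    rewrite scalerBr (mZ _ _ (ltW cp)) scalerA; congr (_ - _ *: _).
    rewrite /c -powRrM divfK ?gt_eqF// powRM ?invr_ge0 ?(ltW ap) ?(ltW vp)//.
    rewrite mulrA -powRD; last by rewrite (gt_eqF ap) implybT.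
    rewrite addrA subrK subrr powRr0 mul1r -(powR_inv1 (ltW vp)) -powRrM.
    by congr (_ `^ _); ring.
  have dv : `|c *: v - v| <= a - b.
    rewrite -{2}[v]scale1r -scalerBl normrZ ger0_norm ?subr_ge0//.
    by rewrite mulrBl mul1r lerD2r.
  have cv0 k : 0 <= coord (c *: v) k.
    by rewrite -[coord (c *: v) k]/(c * coord v k) mulr_ge0// ltW.
  have cva : `|c *: v| <= a by rewrite normrZ ger0_norm// ltW.
  have tri : `|u - v| <= `|u - c *: v| + `|c *: v - v| by exact: ler_distD.
  have tri' : `|u - c *: v| <= `|u - v| + `|c *: v - v|.
    by rewrite (distrC (c *: v)); exact: ler_distD.
  have abu : a - b <= `|u - v| by exact: lerB_dist.
  have abG : a - b <= `|G u - G v| by rewrite /a /b -!Gn; exact: lerB_dist.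
  have a1 : 0 < a `^ (1 - th) by exact: powR_gt0.
  have GEn : `|G u - G v| = a `^ (1 - th) * `|m u - m (c *: v)|.
    by rewrite GE normrZ gtr0_norm.
  split.
    rewrite GEn; apply: le_trans (_ : a `^ (1 - th) * (C * (`|u - c *: v| * a `^ (th - 1))) <= _).
      by rewrite ler_wpM2l ?(ltW a1)//; exact: mle.
    have -> : a `^ (1 - th) * (C * (`|u - c *: v| * a `^ (th - 1))) = C * `|u - c *: v|.
      rewrite mulrCA [a `^ (1 - th) * _]mulrCA -powRD; last by rewrite (gt_eqF ap) implybT.
      by rewrite addrA subrK subrr powRr0 mulr1.
    have -> : 2 * C * `|u - v| = C * (2 * `|u - v|) by ring.
    by apply: ler_wpM2l; [exact: le_trans C1|lra].
  (* In the second case rescaling moves [v] by less than half of the distance, so [u] and [c *: v]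
     are still at least half of it apart. *)
  have [h|h] := leP (`|u - v| / 2) (a - b); [left|right].
    exact: le_trans abG.
  rewrite GEn ler_wpM2l ?(ltW a1)//; apply: le_trans (mge _ _ u0 cv0).
  by apply: le_powR_base; rewrite ?(ltW th0)//; lra.
have key0 (u v : lp p1) : (forall k, 0 <= coord u k) -> (forall k, 0 <= coord v k) ->
    `|G u - G v| <= 2 * C * `|u - v| /\
    (`|u - v| / 2 <= `|G u - G v| \/
     Num.max `|u| `|v| `^ (1 - th) * (`|u - v| / 2) `^ th <= `|G u - G v|).
  wlog vu : u v / `|v| <= `|u|.
    move=> H u0 v0; have /orP[vu|uv] := le_total `|v| `|u|; first exact: H.
    by rewrite (distrC (G u)) (distrC u) maxC; exact: H.
  move=> u0 v0; rewrite (max_l vu).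
  have := normr_ge0 v; rewrite le_eqVlt => /predU1P[vz|]; last exact: key.
  have -> : v = 0 by apply/eqP; rewrite -normr_eq0 -vz.
  have -> : G 0 = 0 by apply/eqP; rewrite -normr_eq0 Gn normr0.
  rewrite !subr0 Gn; have := normr_ge0 u; split; last by left; lra.
  by rewrite ler_peMl//; lra.
exists (G \o P), (2 * C); split=> u v /=.
  have [h _] := key0 _ _ (P0 u) (P0 v); apply: le_trans h _.
  by rewrite ler_wpM2l// mulr_ge0// (le_trans ler01).
have := Pge u v; have [_ [h|h]] := key0 _ _ (P0 u) (P0 v) => Puv; [left|right].
  by apply: le_trans h; lra.
apply: le_trans h; rewrite !Pn ler_wpM2l ?powR_ge0//.
by apply: le_powR_base; rewrite ?(ltW th0)//; have := normr_ge0 (u - v); lra.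
Qed.

(* With [t = |u - v|], the hypothesis [t >= L max(|u|,|v|)^alpha] turns the lower
   bound [max(|u|,|v|)^(1 - p/q) t^(p/q)] into a constant times [t^e], where
   [e > 0] is exactly the condition [alpha > (p - q)/p]. *)
Lemma mazur_expanding (alpha : R) : (p - q) / p < alpha ->
  exists F : lp p1 -> lp q1, coarse F /\ expanding_at_rate alpha F.
Proof.
move=> al; have [F [C [FC Flow]]] := homogeneous_mazur.
have al0 : 0 < alpha by apply: lt_trans al; rewrite divr_gt0// subr_gt0.
exists F; split.
  apply/coarseP => t t0; exists (`|C| * t) => x y xy; apply: le_trans (FC x y) _.
  apply: le_trans (ler_wpM2r (normr_ge0 _) (ler_norm C)) _.
  by rewrite ler_wpM2l.
apply/expanding_at_rateP => L B L0.
pose th := p / q; pose e := th - (th - 1) / alpha.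
have th1 : 1 < th by rewrite ltr_pdivlMr// mul1r.
have th0 : 0 < th by exact: lt_trans th1.
have e0 : 0 < e.
  rewrite subr_gt0 ltr_pdivrMr// mulrC -ltr_pdivrMr//.
  by rewrite (_ : (th - 1) / th = (p - q) / p)// /th; field; rewrite !gt_eqF.
pose c := (L `^ ((1 - th) / alpha))^-1 * 4^-1 `^ th.
have c0 : 0 < c by rewrite mulr_gt0 ?invr_gt0 ?powR_gt0 ?invr_gt0.
pose B' := Num.max B 0.
have B'0 : 0 <= B' by rewrite le_max lexx orbT.
(* One threshold for each alternative of [homogeneous_mazur]. *)
exists (Num.max (4 * B') ((B' / c) `^ e^-1)) => x z; set t := `|x - z|.
set a := Num.max (`|x| `^ alpha) _ => aL.
rewrite ge_max => /andP[tB tB'].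
apply: le_trans (_ : B' <= _); first by rewrite le_max lexx.
case: (Flow x z); first by apply: le_trans; rewrite -/t; lra.
apply: le_trans; set b := Num.max `|x| `|z|; rewrite -/th -/t.
have a0 : 0 <= a by rewrite le_max powR_ge0.
have La0 : 0 <= L * a by rewrite mulr_ge0// ltW.
have t0 : 0 < t by apply: lt_le_trans aL; rewrite ltr_wpDl.
have b0 : 0 < b.
  rewrite /b lt_max; have := lt_le_trans t0 (ler_normB x z).
  by have [//|x0] := ltP 0 `|x|; rewrite (le_anti (introT andP (conj x0 (normr_ge0 x)))) add0r.
have ba : b `^ alpha = a.
  rewrite /b /a; have [xz|zx] := leP `|x| `|z|.
    by rewrite max_r// le_powR_base// ltW.
  by rewrite max_l// le_powR_base// ltW.
have bt : b <= (t / L) `^ alpha^-1.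
  apply: (powR_le_cancel al0); rewrite ?powR_ge0 ?(ltW b0)//.
  rewrite -powRrM mulVf ?gt_eqF// powRr1 ?divr_ge0 ?(ltW t0) ?(ltW L0)//.
  by rewrite ba ler_pdivlMr// mulrC; lra.
(* The exponent [1 - th] is negative, so the upper bound on [b] becomes a lower bound. *)
have bt' : (t / L) `^ ((1 - th) / alpha) <= b `^ (1 - th).
  have -> : (1 - th) / alpha = alpha^-1 * (1 - th) by rewrite mulrC.
  rewrite powRrM -[1 - th]opprB !powRN lef_pV2 ?posrE ?powR_gt0 ?divr_gt0//.
  by apply: le_powR_base; rewrite ?subr_ge0 ?(ltW th1) ?(ltW b0).
apply: le_trans (_ : c * t `^ e <= _).
  rewrite mulrC -ler_pdivrMr//.
  apply: le_trans (_ : ((B' / c) `^ e^-1) `^ e <= _).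
    by rewrite -powRrM mulVf ?gt_eqF// powRr1// divr_ge0// ltW.
  by apply: le_powR_base; rewrite ?powR_ge0 ?(ltW e0).
have -> : c * t `^ e = (t / L) `^ ((1 - th) / alpha) * (t / 4) `^ th.
  rewrite !powRM ?invr_ge0 ?(ltW t0) ?(ltW L0)//.
  have -> : L^-1 `^ ((1 - th) / alpha) = (L `^ ((1 - th) / alpha))^-1.
    by rewrite -(powR_inv1 (ltW L0)) -powRrM mulN1r powRN.
  rewrite mulrACA -powRD; last by rewrite (gt_eqF t0) implybT.
  rewrite mulrC /c /e; congr (_ `^ _ * _); ring.
by rewrite ler_wpM2r ?powR_ge0.
Qed.

End homogeneous_mazur.

(** * Coarse embeddings of the Hilbert space *)

Section fock_map.
Context (R : realType).

Definition tens (x u : nat -> R) : nat -> R :=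
  fam (fun kc : nat * nat => x kc.1 * u kc.2).

(** Tensor powers, re-enumerated as sequences at each stage; the zeroth power is the vacuum
    vector. *)
Fixpoint tpow (x : nat -> R) (n : nat) : nat -> R :=
  if n is n.+1 then tens x (tpow x n) else fun c => (c == 0)%:R.

Lemma tpow_ge0 x n c : (forall k, 0 <= x k) -> 0 <= tpow x n c.
Proof.
move=> x0; elim: n c => [|n IH] c; first exact: ler0n.
by rewrite /= /tens /fam; case: pickle_inv => // -[i j]; rewrite mulr_ge0/=.
Qed.

Lemma tens_hsum (x y u v : nat -> R) A B :
  hsum (fun k => x k * y k) A -> hsum (fun c => u c * v c) B ->
  hsum (fun c => tens x u c * tens y v c) (A * B).
Proof.
move=> hA hB; have [A0 _] := hA.
have hAB : hsum (fun kc : nat * nat => (x kc.1 * u kc.2) * (y kc.1 * v kc.2)) (A * B).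
  apply: (hsum_prod (h := fun k c => x k * u c * (y k * v c))
    (s := fun k => x k * y k * B)) => [k|].
    by apply: eq_hsum (hsumZ (A0 k) hB) => c; rewrite mulrACA.
  by rewrite mulrC; apply: eq_hsum (hsumZ (hsum_ge0 hB) hA) => k; rewrite mulrC.
apply: eq_hsum (hsum_fam hAB) => c.
by rewrite (fam2 (F := fun a b => a * b))// mulr0.
Qed.

Lemma tpow_hsum (x y : nat -> R) A n : hsum (fun k => x k * y k) A ->
  hsum (fun c => tpow x n c * tpow y n c) (A ^+ n).
Proof.
move=> hA; elim: n => [|n IH]; last by rewrite exprS; exact: tens_hsum.
rewrite expr0; apply: (@hsum_inj _ unit _ (fun=> 0)) => [[] []//|[|c]|].
- by move=> /(_ tt).
- by rewrite mul0r.
- have := @hsum_fin R unit (fun=> 1) (fun=> ler01).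
  by rewrite big_const card_unit /= addr0; apply: eq_hsum => i; rewrite /= mulr1.
Qed.

Lemma hsum_expR (x : R) : 0 <= x -> hsum (fun n => x ^+ n / n`!%:R) (expR x).
Proof.
move=> x0; apply: hsum_cvg; first by move=> n; rewrite divr_ge0 ?exprn_ge0.
exact: (is_cvg_series_exp_coeff x).
Qed.

(* The coordinates of [exp(-t |x|^2)] times the exponential vector of
   [sqrt (2 t) x] in the full Fock space; [X] stands for [|x|^2]. *)
Definition gauss (t : R) (X : R) (x : nat -> R) (i : nat * nat) : R :=
  expR (- (t * X)) * Num.sqrt ((2 * t) ^+ i.1 / i.1`!%:R) * tpow x i.1 i.2.

(** Inner products of [n]-th tensor powers are [A ^+ n], so level [n] contributes a term of the
    exponential series of [2 * t * A]. *)
Lemma gauss_hsum (t X Y A : R) (x y : nat -> R) : 0 <= t ->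
  hsum (fun k => x k * y k) A ->
  hsum (fun i => gauss t X x i * gauss t Y y i) (expR (- (t * (X + Y - 2 * A)))).
Proof.
move=> t0 hA; have A0 := hsum_ge0 hA.
pose E := expR (- (t * X)) * expR (- (t * Y)).
have E0 : 0 <= E by rewrite mulr_ge0 ?expR_ge0.
pose c n : R := (2 * t) ^+ n / n`!%:R.
have c0 n : 0 <= c n by rewrite divr_ge0 ?exprn_ge0 ?mulr_ge0.
apply: (hsum_prod (h := fun n k => gauss t X x (n, k) * gauss t Y y (n, k))
  (s := fun n => E * ((2 * t * A) ^+ n / n`!%:R))) => [n|].
  have -> : E * ((2 * t * A) ^+ n / n`!%:R) = E * c n * A ^+ n.
    by rewrite /c exprMn; ring.
  apply: eq_hsum (hsumZ (mulr_ge0 E0 (c0 n)) (tpow_hsum n hA)) => k.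
  rewrite /gauss/= -/(c n) -{1}(sqr_sqrtr (c0 n)) /E; ring.
have -> : expR (- (t * (X + Y - 2 * A))) = E * expR (2 * t * A).
  by rewrite /E -!expRD; congr expR; ring.
by apply: hsumZ => //; apply: hsum_expR; rewrite !mulr_ge0.
Qed.

End fock_map.

Section gaussian_map.
Context (R : realType) (p1 : 1 <= 2 :> R).
Notation l2 := (lp p1).

Lemma l2_hsum (u : l2) : hsum (fun k => coord u k * coord u k) (`|u| ^+ 2).
Proof.
rewrite -powR_mulrn//; apply: eq_hsum (lp_hsum u) => k.
by rewrite powR_mulrn// real_normK ?num_real// expr2.
Qed.

(** Summability comes from [2 x y <= x^2 + y^2]; nonnegative coordinates make the inner product an
    [hsum]. *)
Lemma l2_inner (u v : l2) : (forall k, 0 <= coord u k) -> (forall k, 0 <= coord v k) ->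
  exists2 A, hsum (fun k => coord u k * coord v k) A &
    `|u - v| ^+ 2 = `|u| ^+ 2 + `|v| ^+ 2 - 2 * A.
Proof.
move=> u0 v0; have huv := hsumD (l2_hsum u) (l2_hsum v).
have [S hS _] : exists2 S, hsum (fun k => 2 * (coord u k * coord v k)) S &
    S <= `|u| ^+ 2 + `|v| ^+ 2.
  apply: hsum_dom huv => k; first by rewrite !mulr_ge0.
  have := sqr_ge0 (coord u k - coord v k); rewrite sqrrB !expr2; lra.
have i2 : 0 <= 2^-1 :> R by rewrite invr_ge0.
exists (2^-1 * S).
  by apply: eq_hsum (hsumZ i2 hS) => k; rewrite mulKf.
rewrite mulrA divff// mul1r; apply: hsum_unique (l2_hsum (u - v)) _.
apply: hsum_subr hS _ => [k|]; first by rewrite -expr2 sqr_ge0.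
by apply: eq_hsum huv => k; rewrite coordB; ring.
Qed.

(** The images are unit vectors, so their squared distance is twice one minus their inner product,
    and that inner product is the Gaussian kernel. *)
Lemma gaussian_map (t : R) : 0 <= t -> exists G : l2 -> l2,
  [/\ forall u, `|G u| = 1,
      forall u, (forall k, 0 <= coord u k) -> forall k, 0 <= coord (G u) k &
      forall u v, (forall k, 0 <= coord u k) -> (forall k, 0 <= coord v k) ->
        `|G u - G v| ^+ 2 = 2 * (1 - expR (- (t * `|u - v| ^+ 2)))].
Proof.
move=> t0; pose g (u : l2) := gauss t (`|u| ^+ 2) (coord u).
have gn u : hsum (fun i => g u i * g u i) 1.
  have := gauss_hsum (`|u| ^+ 2) (`|u| ^+ 2) t0 (l2_hsum u).
  by rewrite (_ : _ + _ - _ = 0) ?mulr0 ?oppr0 ?expR0//; ring.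
have sq (a : R) : a * a = `|a| `^ 2 by rewrite powR_mulrn// real_normK ?num_real// expr2.
have [u|G [Gc Gn Gd]] := @fam_lp R 2 p1 (nat * nat)%type l2 g.
  by exists 1; apply: eq_hsum (gn u) => i; rewrite sq.
exists G; split=> [u|u u0 k|u v u0 v0].
- have /Gn : hsum (fun i => `|g u i| `^ 2) 1 by apply: eq_hsum (gn u) => i; rewrite sq.
  rewrite powR_mulrn// => /eqP; rewrite sqrf_eq1 => /orP[/eqP//|/eqP h].
  by have := normr_ge0 (G u); rewrite h; lra.
- rewrite Gc /fam; case: pickle_inv => // i.
  by rewrite /g /gauss !mulr_ge0 ?expR_ge0 ?sqrtr_ge0// tpow_ge0.
have [A hA ->] := l2_inner u0 v0; rewrite -powR_mulrn//; apply: Gd.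
have hG := hsumZ (ler0n R 2) (gauss_hsum (`|u| ^+ 2) (`|v| ^+ 2) t0 hA).
have -> : 2 * (1 - expR (- (t * (`|u| ^+ 2 + `|v| ^+ 2 - 2 * A)))) =
  1 + 1 - 2 * expR (- (t * (`|u| ^+ 2 + `|v| ^+ 2 - 2 * A))) by ring.
apply: hsum_subr hG _ => [i|]; first exact: powR_ge0.
apply: eq_hsum (hsumD (gn u) (gn v)) => i.
by rewrite -sq -!/(g _ _); ring.
Qed.

(* Mazur's map carries the Gaussian embeddings at the scales [4^-n] into [l_q],
   where their direct sum converges. *)
Lemma coarse_embedding_l2 (q : R) (q1 : 1 <= q) : q < 2 ->
  exists F : l2 -> lp q1,
    (exists C, forall u v, `|F u - F v| <= C * `|u - v|) /\
    (forall B, exists T, forall u v, T <= `|u - v| -> B <= `|F u - F v|).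
Proof.
move=> q2; have q0 : 0 < q by exact: lt_le_trans q1.
have [m [C [C1 _ mc mge mle]]] := @mazur R 2 q p1 q1 q2.
have [P [P0 Pn Ple Pge]] := positive_parts p1.
pose t n : R := (2^-1 ^+ n) ^+ 2.
have t0 n : 0 <= t n by exact: sqr_ge0.
pose G n := projT1 (cid (gaussian_map (t0 n))).
have GP n : [/\ forall u, `|G n u| = 1,
      forall u, (forall k, 0 <= coord u k) -> forall k, 0 <= coord (G n u) k &
      forall u v, (forall k, 0 <= coord u k) -> (forall k, 0 <= coord v k) ->
        `|G n u - G n v| ^+ 2 = 2 * (1 - expR (- (t n * `|u - v| ^+ 2)))].
  exact: projT2 (cid (gaussian_map (t0 n))).
pose M n u := m (G n (P u)).
have Gpos n u k : 0 <= coord (G n (P u)) k by have [_ + _] := GP n; apply.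
(* From [1 - exp(-x) <= x] and the Lipschitz bound of [m] on the unit ball; the factor [2^-1 ^+ n]
   makes the sum over scales converge. *)
have Mup n u v : `|M n u - M n v| <= 2 * C * `|u - v| * 2^-1 ^+ n.
  have [G1 _ Gd] := GP n.
  apply: le_trans (mle _ _ 1 (Gpos n u) (Gpos n v) _ _) _; rewrite ?G1//.
  rewrite powR1 mulr1 (mulrC 2) -!mulrA ler_wpM2l ?(le_trans ler01)//.
  rewrite -ler_sqr ?nnegrE ?mulr_ge0 ?exprn_ge0 ?invr_ge0// Gd//.
  apply: le_trans (_ : 2 * (t n * `|P u - P v| ^+ 2) <= _).
    rewrite ler_wpM2l// lerBlDl -lerBlDr.
    by have := expR_ge1Dx (- (t n * `|P u - P v| ^+ 2)); lra.
  have : `|P u - P v| ^+ 2 <= `|u - v| ^+ 2 by rewrite lerXn2r ?nnegrE.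
  rewrite /t !exprMn; set a := (_ ^+ n) ^+ 2; set b := `|u - v| ^+ 2.
  have a0 : 0 <= a by exact: sqr_ge0.
  have b0 : 0 <= b by exact: sqr_ge0.
  move=> h; have := ler_wpM2l a0 h; have := mulr_ge0 a0 b0; lra.
(* Beyond distance [2 ^+ n] the kernel is at most 1/2, so the Gaussian images, and then their Mazur
   images, are at least 1 apart. *)
have Mlow n u v : 2 ^+ n <= `|P u - P v| -> 1 <= `|M n u - M n v|.
  move=> h; have [_ _ Gd] := GP n; apply: le_trans (mge _ _ (Gpos n u) (Gpos n v)).
  apply: powR_ge1; first by rewrite divr_ge0 ?ltW.
  rewrite -ler_sqr ?nnegrE// Gd// expr1n.
  have t1 : 1 <= t n * `|P u - P v| ^+ 2.
    rewrite /t -exprMn expr_ge1 ?mulr_ge0 ?exprn_ge0 ?invr_ge0//.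
    by rewrite exprVn ler_pdivlMl ?exprn_gt0// mulr1.
  have : expR (- (t n * `|P u - P v| ^+ 2)) <= 2^-1.
    rewrite expRN lef_pV2 ?posrE ?expR_gt0//.
    by apply: le_trans (expR_ge1Dx _); lra.
  lra.
(* Subtracting the image of 0 at every scale makes the direct sum finite. *)
pose g u (i : nat * nat) := coord (M i.1 u) i.2 - coord (M i.1 0) i.2.
pose z : R := 2^-1 `^ q.
have z1 : z < 1.
  rewrite /z -(powR_inv1 (ler0n R 2)) -powRrM mulN1r.
  by apply: powR2_lt1; rewrite oppr_lt0.
have hD u v : exists S, [/\ hsum (fun n => `|M n u - M n v| `^ q) S &
    S <= (2 * C * `|u - v|) `^ q * (1 - z)^-1].
  have [|S hS SS] := @hsum_dom R nat _ _ _ (fun n => powR_ge0 `|M n u - M n v| q) _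
    (hsumZ (powR_ge0 (2 * C * `|u - v|) q) (hsum_geometric (powR_ge0 _ _) z1)).
    move=> n /=; apply: le_trans (le_powR_base (ltW q0) (normr_ge0 _) (Mup n u v)) _.
    rewrite powRM ?mulr_ge0 ?(le_trans ler01 C1) ?exprn_ge0 ?invr_ge0//.
    by rewrite -!powR_mulrn ?invr_ge0 ?powR_ge0// powRAC.
  by exists S.
have [u|F [_ _ Fd]] := @fam_lp R q q1 (nat * nat)%type l2 g.
  have [S [hS _]] := hD u 0; exists S.
  apply: (hsum_prod (h := fun n k => `|g u (n, k)| `^ q)) hS => n.
  exact: (lp_hsum (M n u - M n 0)).
have Fn u v S : hsum (fun n => `|M n u - M n v| `^ q) S -> `|F u - F v| `^ q = S.
  move=> hS; apply: Fd.
  apply: (hsum_prod (h := fun n k => `|g u (n, k) - g v (n, k)| `^ q)) hS => n.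
  apply: eq_hsum (lp_hsum (M n u - M n v)) => k.
  by rewrite coordB /g/=; congr (`|_| `^ _); ring.
exists F; split.
  exists (2 * C * ((1 - z)^-1) `^ q^-1) => u v.
  have [S [/Fn FS SS]] := hD u v.
  have z2 : 0 <= (1 - z)^-1 by rewrite invr_ge0 subr_ge0 ltW.
  have C0 : 0 <= C by exact: le_trans C1.
  apply: (powR_le_cancel q0); rewrite ?mulr_ge0 ?powR_ge0// FS.
  rewrite mulrAC powRM ?mulr_ge0 ?powR_ge0//.
  by rewrite -powRrM mulVf ?gt_eqF// powRr1.
(* At distance at least [2 * 2 ^+ N] each of the first [N] scales contributes at least 1; the factor
   2 is lost in [P]. *)
move=> B; pose N := (Num.trunc (Num.max B 0 `^ q)).+1.
have BN : Num.max B 0 `^ q <= N%:R by rewrite ltW// truncnS_gt.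
clearbody N; exists (2 * 2 ^+ N) => u v Tuv.
apply: le_trans (_ : Num.max B 0 <= _); first by rewrite le_max lexx.
apply: (powR_le_cancel q0); rewrite ?le_max ?lexx ?orbT//.
apply: le_trans BN _; have [S [hS _]] := hD u v; rewrite (Fn _ _ _ hS).
apply: le_trans (hsum_seq_le (iota_uniq 0 N) hS).
rewrite -[leLHS](_ : \sum_(i <- iota 0 N) 1 = _); last first.
  by rewrite big_const_seq count_predT size_iota iter_addr_0.
rewrite big_seq_cond [leRHS]big_seq_cond ler_sum// => n.
rewrite mem_iota add0n andbT => /andP[_ nN].
apply: powR_ge1; first exact: ltW.
apply: Mlow; apply: le_trans (_ : 2 ^+ N <= _).
  by rewrite ler_eXn2l ?ltr1n// ltnW.
by have := Pge u v; lra.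
Qed.

End gaussian_map.

(** * Composition and the two equivalences *)

Section composition.
Context (R : realType) (X Y Z : completeNormedModType R).

Lemma expanding_comp (alpha : R) (f : X -> Y) (g : Y -> Z) :
  coarse f -> expanding_at_rate alpha f ->
  (exists C, forall u v, `|g u - g v| <= C * `|u - v|) ->
  (forall B, exists T, forall u v, T <= `|u - v| -> B <= `|g u - g v|) ->
  coarse (g \o f) /\ expanding_at_rate alpha (g \o f).
Proof.
move=> /coarseP fc /expanding_at_rateP fe [C gC] gB; split.
  apply/coarseP => t t0; have [A fA] := fc t t0.
  exists (`|C| * A) => x y xy; apply: le_trans (gC _ _) _.
  apply: le_trans (ler_wpM2r (normr_ge0 _) (ler_norm C)) _.
  by rewrite ler_wpM2l// fA.
apply/expanding_at_rateP => L B L0; have [S gS] := gB B.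
have [T fT] := fe L S L0; exists T => x z Lxz Txz.
by apply: gS; exact: fT.
Qed.

End composition.

Theorem corollary3p4 (R : realType) (p q alpha : R)
    (p1 : 1 <= p) (q1 : 1 <= q) (qp : q < p) (alpha01 : 0 <= alpha <= 1) :
  (2 <= q ->
    (exists f : lp p1 -> lp q1, coarse f /\ expanding_at_rate alpha f) <->
    alpha > (p - q) / p) /\
  (q <= 2 < p ->
    (exists f : lp p1 -> lp q1, coarse f /\ expanding_at_rate alpha f) <->
    alpha > (p - 2) / p).
Proof.
have /andP[al0 _] := alpha01; have q0 : 0 < q by exact: lt_le_trans q1.
have part1 : 2 <= q ->
    (exists f : lp p1 -> lp q1, coarse f /\ expanding_at_rate alpha f) <->
    alpha > (p - q) / p.
  move=> q2; split=> [[f [fc fe]]|]; last exact: mazur_expanding.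
  rewrite ltNge; apply/negP => al.
  exact: (not_expanding q2 qp q0 ltr01 ltr01 (@coord_family R q q1) al0 al fc fe).
split=> // /andP[q2 p2].
(* At [q = 2] the two thresholds coincide. Below 2, the trigonometric family gives the obstruction
   with exponent 2, and existence passes through l_2. *)
have [qE|qn] := eqVneq q 2; first by rewrite -qE; apply: part1; rewrite qE.
have {qn}q2 : q < 2 by rewrite lt_neqAle qn.
split=> [[f [fc fe]]|al].
  rewrite ltNge; apply/negP => al.
  have [c [C [c0 C0 hS]]] := trig_familyP q1 q2.
  exact: (not_expanding (lexx 2) p2 q0 c0 C0 hS al0 al fc fe).
have e1 : 1 <= 2 :> R by rewrite ler1n.
have [f [fc fe]] := @mazur_expanding R p 2 p1 e1 p2 alpha al.
have [g [gC gB]] := coarse_embedding_l2 e1 q1 q2.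
by exists (g \o f); exact: expanding_comp.
Qed.
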